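(* Let $\mathfrak{g}\subset\mathbb{R}^{n\times n}$ be a matrix Lie algebra, $J$ the objective of a Gaussian Lie-algebraic policy with Fisher information matrix $F(\theta)$, and let $\theta_{t+1}=\theta_t+\eta_tP_{\mathfrak g}(g_t)$ with $g_t=\widehat{\nabla}J(\theta_t)$. Suppose assumptions (A1)–(A6) and the alignment assumption of the context hold, with alignment parameter $\alpha\in(0,1]$ and Fisher condition number $\kappa=\lambda_{\max}(F)/\lambda_{\min}(F)$. Write $\nabla_{\mathfrak g}J=P_{\mathfrak g}(\nabla J)$. Then: (i) (Euclidean convergence) With step sizes $\eta_t=\eta/\sqrt T$, $\eta\le1/L$, $$\min_{0\le t\le T-1}\mathbb{E}\big[\|\nabla_{\mathfrak g}J(\theta_t)\|_F^2\big]\le\frac{2(J^*-J(\theta_0))}{\eta\sqrt{T}}+\frac{L\eta\sigma_g^2}{\sqrt{T}}.$$ (ii) (Natural gradient stationarity conversion) At any iterate $\theta_t$, $$\frac{1}{\lambda_{\max}(F)}\|\nabla_{\mathfrak g}J\|_F^2\le\langle\nabla J,F^{-1}\nabla J\rangle\le\frac1{\lambda_{\min}(F)}\|\nabla_{\mathfrak g}J\|_F^2;$$ thus $\|\nabla_{\mathfrak g}J\|_F^2\le\varepsilon$ implies $\langle\nabla J,F^{-1}\nabla J\rangle\le\varepsilon/\lambda_{\min}(F)$. (iii) (Directional quality) At each iterate, the update direction $d_t=\nabla_{\mathfrak g}J(\theta_t)$ satisfies $$\cos\big(d_t,\,F(\theta_t)^{-1}\nabla J(\theta_t)\big)\ge\alpha\ge\frac{2\sqrt{\kappa}}{\kappa+1},$$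 so the Euclidean step is within angle $\arccos(\alpha)$ of the natural gradient direction.
   Context: $\langle A,B\rangle_F=\mathrm{tr}(A^\top B)$; $P_{\mathfrak g}$ is the Frobenius-orthogonal projector onto $\mathfrak g$; $d_{\mathfrak g}=\dim\mathfrak g$; $\mathbb{R}^{d_{\mathfrak g}}\cong\mathfrak g$ via a fixed Frobenius-orthonormal basis, so gradients with respect to $\theta$ are regarded as elements of $\mathfrak{g}\cong\mathbb{R}^{d_{\mathfrak g}}$. $\cos(u,v)=\langle u,v\rangle/(\|u\|\|v\|)$. Gaussian Lie-algebraic policy: $a=\mu_\theta(s)+\xi$, $\xi\sim\mathcal{N}(0,\sigma^2I_{d_{\mathfrak g}})$, $\mu_\theta(s)=\sum_k\theta_k\Phi_k(s)\in\mathfrak g$ with features $\Phi_k:\mathcal{S}\to\mathfrak g$. $J(\theta)=\mathbb{E}_{\pi_\theta}[\sum_{t\ge0}\gamma^tr_t]$. Fisher matrix: $F(\theta)=\mathbb{E}_{s\sim d^{\pi_\theta},a\sim\pi_\theta}[\nabla_\theta\log\pi_\theta(\nabla_\theta\log\pi_\theta)^\top]\in\mathbb{R}^{d_{\mathfrak g}\times d_{\mathfrak g}}$, where $d^{\pi_\theta}(s)=(1-\gamma)\sum_{t\ge0}\gamma^t\Pr(s_t=s\mid\pi_\theta)$; the natural gradient is $F^{-1}\nabla J$. Assumptions: (A1) $\|\nabla J(\theta)-\nabla J(\theta')\|_F\le L\|\theta-\theta'\|_F$. (A2) $J^*=\sup_\theta J(\theta)<\infty$. (A3) $\sup_t\|\theta_t\|_F\le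 B_\theta$. (A4) $\mathbb{E}[\widehat\nabla J(\theta)]=\nabla J(\theta)$ (conditionally on the past at $\theta=\theta_t$). (A5) $\mathbb{E}[\|\widehat\nabla J-\nabla J\|_F^2]\le\sigma_g^2$ (same convention). (A6) $\sum_t\eta_t=\infty$, $\sum_t\eta_t^2<\infty$; for the $\mathcal{O}(1/\sqrt T)$ rate, $\eta_t=\eta/\sqrt T$ with $\eta\le1/L$. Alignment assumption: there is $\alpha\in(0,1]$ such that for all $\theta$ along the optimization trajectory, $\cos\big(P_{\mathfrak g}(\nabla J(\theta)),F(\theta)^{-1}\nabla_\theta J(\theta)\big)\ge\alpha$.
   Formalization: In (iii), α ≥ 2√κ/(κ+1) fails for arbitrary α (F=I, α=1/2); it is proved for the largest alignment constant, with κ any a.s. bound on the condition numbers; cos ≥ 2√κ/(κ+1) holds at each iterate with ∇J≠0. (A6) is read as either step-size regime. *)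

(* Defs.v *)
From HB Require Import structures.
From mathcomp Require Import all_boot all_order all_algebra.
From mathcomp Require Import all_classical all_reals all_analysis.

Set Implicit Arguments.
Unset Strict Implicit.
Unset Printing Implicit Defensive.

Import Order.TTheory GRing.Theory Num.Theory.
Import numFieldNormedType.Exports.

Local Open Scope classical_set_scope.
Local Open Scope ring_scope.

Section frobenius.
Context {R : realType} {n : nat}.
Implicit Types (A B : 'M[R]_n) (g : {vspace 'M[R]_n}).

Definition frob A B : R := \tr (A^T *m B).
Definition fnorm A : R := Num.sqrt (frob A A).
Definition fcos A B : R := frob A B / (fnorm A * fnorm B).

Definition lie_algebra g : Prop :=
  forall A B, A \in g -> B \in g -> A *m B - B *m A \in g.

Definition orthonormal_basis g (E : (\dim g).-tuple 'M[R]_n) : Prop :=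
  basis_of g E /\ forall i j, frob (tnth E i) (tnth E j) = (i == j)%:R.

Section frame.
Context {m : nat} (E : m.-tuple 'M[R]_n).

(* The identification of R^m with the span of E. *)
Definition of_coord (x : 'rV[R]_m) : 'M[R]_n := \sum_i x 0 i *: tnth E i.

Definition to_coord (A : 'M[R]_n) : 'rV[R]_m := \row_i frob (tnth E i) A.

(* P_g, by its expression in an orthonormal basis; see [orth_projP]. *)
Definition orth_proj (A : 'M[R]_n) : 'M[R]_n := of_coord (to_coord A).

End frame.

Lemma frobDr A B C : frob A (B + C) = frob A B + frob A C.
Proof. by rewrite /frob mulmxDr mxtraceD. Qed.

Lemma frobZr A k B : frob A (k *: B) = k * frob A B.
Proof. by rewrite /frob -scalemxAr mxtraceZ. Qed.

Lemma frobC A B : frob A B = frob B A.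
Proof. by rewrite /frob -mxtrace_tr trmx_mul trmxK. Qed.

Lemma frob_sumr A (I : finType) (F : I -> 'M[R]_n) :
  frob A (\sum_i F i) = \sum_i frob A (F i).
Proof. by rewrite /frob mulmx_sumr raddf_sum. Qed.

Lemma orth_projP g (E : (\dim g).-tuple 'M[R]_n) A :
  orthonormal_basis E ->
  orth_proj E A \in g /\ forall X, X \in g -> frob X (A - orth_proj E A) = 0.
Proof.
move=> [bE oE]; split.
  apply: memv_suml => i _; apply: memvZ.
  by apply: (basis_mem bE); exact: mem_tnth.
move=> X /(coord_basis bE) ->.
rewrite frobC frob_sumr big1// => i _.
rewrite frobZr frobC -(tnth_nth 0) -scaleN1r frobDr frobZr frob_sumr.
rewrite (bigD1 i)//= frobZr oE eqxx mulr1 mxE big1 ?addr0.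
  by rewrite mulN1r subrr mulr0.
by move=> j ji; rewrite frobZr oE eq_sym (negbTE ji) mulr0.
Qed.

End frobenius.

Section eigenvalues.
Context {R : realType} {m : nat}.
Implicit Type F : 'M[R]_m.

Definition lambda_max F : R := sup [set a : R | eigenvalue F a].
Definition lambda_min F : R := inf [set a : R | eigenvalue F a].
Definition cond_number F : R := lambda_max F / lambda_min F.

End eigenvalues.

Definition gradient {R : realType} {m : nat} (f : 'rV[R]_m -> R)
  (x : 'rV[R]_m) : 'rV[R]_m := \row_i 'D_(delta_mx 0 i) f x.

Section iid.
Context {R : realType} {d : measure_display} {T : measurableType d}
  (mu : probability T R).

Definition consp m (x : T * m.-tuple T) : m.+1.-tuple T :=
  [tuple of x.1 :: x.2].

Lemma measurable_consp m : measurable_fun [set: T * m.-tuple T] (@consp m).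
Proof. by apply: measurable_cons; [exact: measurable_fst|exact: measurable_snd]. Qed.

HB.instance Definition _ m :=
  @isMeasurableFun.Build _ _ _ _ (@consp m) (@measurable_consp m).

(* The law of m independent random variables of law mu. *)
Fixpoint iid m : probability (m.-tuple T) R :=
  match m with
  | 0 => dirac [tuple]
  | k.+1 => distribution (mu \x iid k)%E (@consp k)
  end.

End iid.

(* R^m with the product of the Borel sigma-algebras. *)
Notation euclidean R m := (m.-tuple (measurableTypeR R)).

(* N(0, sigma^2 I_m) on R^m. *)
Definition gaussian {R : realType} (m : nat) (sigma : R) :
  probability (euclidean R m) R := iid (normal_prob 0 sigma) m.

(* Actions live in the Lie algebra and are recorded by their coordinates in the
   orthonormal frame E, i.e. as elements of R^m. *)
Section gaussian_policy.
Context {R : realType} {n m : nat} {dS : measure_display}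
  {S : measurableType dS}.
Variables (E : m.-tuple 'M[R]_n) (Phi : 'I_m -> S -> 'M[R]_n) (sigma : R).
Implicit Types (theta : 'rV[R]_m) (s : S) (a xi : euclidean R m).

Definition mean theta s : 'M[R]_n := \sum_k theta 0 k *: Phi k s.

Definition act theta s xi : euclidean R m :=
  [tuple (to_coord E (mean theta s) 0 i + (tnth xi i : R) : measurableTypeR R) | i < m].

Definition policy theta s (C : set (euclidean R m)) : \bar R :=
  gaussian m sigma (act theta s @^-1` C).

(* Density of [policy theta s] with respect to Lebesgue measure on R^m. *)
Definition policy_pdf theta s a : R :=
  \prod_i normal_pdf (to_coord E (mean theta s) 0 i) sigma (tnth a i).

Definition score theta s a : 'rV[R]_m :=
  gradient (fun theta' => ln (policy_pdf theta' s a)) theta.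

(* E_{s ~ mu, a ~ pi_theta(.|s)} [f s a], with a = mu_theta(s) + xi. *)
Definition policy_expectation (mu : {measure set S -> \bar R}) theta
    (f : S -> euclidean R m -> R) : \bar R :=
  (\int[mu]_s \int[gaussian m sigma]_xi (f s (act theta s xi))%:E)%E.

Definition fisher (mu : {measure set S -> \bar R}) theta : 'M[R]_m :=
  \matrix_(i, j) fine (policy_expectation mu theta
    (fun s a => score theta s a 0 i * score theta s a 0 j)).

Definition fisher_finite (mu : {measure set S -> \bar R}) theta : Prop :=
  forall i, (policy_expectation mu theta
    (fun s a => score theta s a 0 i ^+ 2)%R < +oo)%E.

End gaussian_policy.

Record mdp (R : realType) (dS dA : measure_display) (S : measurableType dS)
    (A : measurableType dA) := Mdp {
  init : probability S R;
  trans : R.-pker (S * A)%type ~> S;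
  reward : {mfun (S * A)%type >-> measurableTypeR R};
  disc : {i01 R};
  disc_lt1 : disc%:num < 1 }.

Section trajectories.
Context {R : realType} {dS dA dO : measure_display} {S : measurableType dS}
  {A : measurableType dA} {Omega : measurableType dO}.
Variables (M : mdp R S A) (s : nat -> {mfun Omega >-> S})
  (a : nat -> {mfun Omega >-> A}).

(* sigma-algebra of s_0, ..., s_(p-1), a_0, ..., a_(q-1) *)
Definition history (p q : nat) : set (set Omega) :=
  <<s [set H | exists i B, [/\ (i < p)%N, measurable B & H = s i @^-1` B]] `|`
      [set H | exists i C, [/\ (i < q)%N, measurable C & H = a i @^-1` C]] >>.

(* Under P, (s_t, a_t) is the state-action process of the policy pi in M. *)
Definition trajectory_law (pi : S -> set A -> \bar R)
    (P : probability Omega R) : Prop :=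
  [/\ forall B, measurable B -> P (s 0%N @^-1` B) = init M B,
      forall t H C, history t.+1 t H -> measurable C ->
        P (H `&` a t @^-1` C) = (\int[P]_(w in H) pi (s t w) C)%E
    & forall t H B, history t.+1 t.+1 H -> measurable B ->
        P (H `&` s t.+1 @^-1` B) =
        (\int[P]_(w in H) trans M (s t w, a t w) B)%E].

Definition total_return (w : Omega) : R :=
  limn (series (fun t => (disc M)%:num ^+ t * reward M (s t w, a t w))).

Definition return_integrable (P : probability Omega R) : Prop :=
  (\int[P]_w (\sum_(0 <= t <oo)
     ((disc M)%:num ^+ t * `|reward M (s t w, a t w)|)%:E) < +oo)%E.

(* d^pi = (1 - gamma) \sum_t gamma^t Pr(s_t in .) *)
Definition visitation (P : probability Omega R) : {measure set S -> \bar R} :=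
  mscale (1 - (disc M)%:num)%:nng
    (mseries (fun t => mscale ((disc M)%:num ^+ t)%:nng
                              (distribution P (s t))) 0).

End trajectories.

Section conditioning.
Context {R : realType} {dW : measure_display} {W : measurableType dW}.
Variables (Q : probability W R) (G : set (set W)).
Implicit Types X Y : W -> R.

(* Y = E[X | G] *)
Definition cond_expectation X Y : Prop :=
  [/\ Q.-integrable setT (EFin \o X),
      forall B : set (measurableTypeR R), measurable B -> G (Y @^-1` B)
    & forall H, G H ->
        (\int[Q]_(w in H) (X w)%:E = \int[Q]_(w in H) (Y w)%:E)%E].

(* E[X | G] <= c, for X >= 0 *)
Definition cond_expectation_le X (c : R) : Prop :=
  forall H, G H -> (\int[Q]_(w in H) (X w)%:E <= c%:E * Q H)%E.

End conditioning.

(* Sigma-algebra generated by the entries of g_0, ..., g_(t-1). *)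
Definition past {R : realType} {n : nat} {dW : measure_display}
    {W : measurableType dW} (g : nat -> W -> 'M[R]_n) (t : nat) : set (set W) :=
  <<s [set H | exists u i j (B : set (measurableTypeR R)),
        [/\ (u < t)%N, measurable B & H = (fun w => g u w i j) @^-1` B]] >>.

Definition robbins_monro {R : realType} (eta : nat -> R) : Prop :=
  series eta @ \oo --> +oo /\ cvgn (series (fun t => eta t ^+ 2)).

Definition constant_steps {R : realType} (L : R) (T : nat) (eta0 : R)
    (eta : nat -> R) : Prop :=
  [/\ (0 < T)%N, 0 < eta0, eta0 <= 1 / L
    & forall t, (t < T)%N -> eta t = eta0 / Num.sqrt T%:R].

Section ascent.
Context {R : realType} {n m : nat} {dW : measure_display}
  {W : measurableType dW}.
Variables (E : m.-tuple 'M[R]_n) (J : 'rV[R]_m -> R) (F : 'rV[R]_m -> 'M[R]_m)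
  (Q : probability W R) (theta : nat -> W -> 'rV[R]_m).
Implicit Types (x : 'rV[R]_m) (alpha : R).

(* grad J as an element of the Lie algebra *)
Definition lie_grad x : 'M[R]_n := of_coord E (gradient J x).

Definition nat_grad x : 'M[R]_n :=
  of_coord E (invmx (F x) *m (gradient J x)^T)^T.

Definition grad_cos x : R := fcos (orth_proj E (lie_grad x)) (nat_grad x).

(* The cosine is undefined where grad J = 0, hence the guard. *)
Definition alignment alpha : Prop :=
  0 < alpha <= 1 /\
  {ae Q, forall w, forall t, gradient J (theta t w) != 0 ->
    alpha <= grad_cos (theta t w)}.

Definition best_alignment alpha : Prop :=
  alignment alpha /\ forall beta, alignment beta -> beta <= alpha.

End ascent.

(* Main.v *)
Require Import Defs.
From HB Require Import structures.
From mathcomp Require Import all_boot all_order all_algebra.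
From mathcomp Require complex.
From mathcomp Require Import all_classical all_reals all_analysis.
From mathcomp Require Import measurable_realfun ring lra.

(* (i) Along each path, L-smoothness gives
     J(theta_(t+1)) - J(theta_t) >= (eta/2) |grad J|^2 + (eta - L eta^2) <grad J, xi_t>
                                    - (L eta^2 / 2) |xi_t|^2,
   where xi_t = g_t - grad J(theta_t), because P_g is a contraction fixing grad J.
   Summing before taking expectations bounds the left side by J* - J(theta_0), so
   that no measurability of J(theta_t) is needed; the middle term has mean 0 since
   grad J(theta_t) is bounded and measurable with respect to the past.
   (ii), (iii) The Fisher matrix is a Gram matrix in L^2, hence positive
   semidefinite. In an orthonormal eigenbasis of F with eigenvalues d_i, and with
   w_i the squared coordinates of v = grad J, the quantities |v|^2, <v, F^-1 v> and
   |F^-1 v|^2 are the sums of w_i, w_i / d_i and w_i / d_i^2; the bounds on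
   <v, F^-1 v> follow termwise and the one on the cosine is Kantorovich's
   inequality. As the ratio 2 sqrt k / (k + 1) is nonincreasing for k >= 1, its
   value at a bound of all condition numbers is itself an alignment parameter, hence
   at most the largest one, which exists because a supremum of alignment parameters
   is approached by a sequence. *)

Set Implicit Arguments.
Unset Strict Implicit.
Unset Printing Implicit Defensive.

Import Order.TTheory GRing.Theory Num.Theory.
Import numFieldNormedType.Exports.

Local Open Scope classical_set_scope.
Local Open Scope ring_scope.

(** * Frobenius geometry and orthonormal coordinates *)

Section frobenius_theory.
Context {R : realType} {n : nat}.
Implicit Types A B C : 'M[R]_n.

Lemma frobE A B : frob A B = \sum_i \sum_j A i j * B i j.
Proof.
rewrite /frob /mxtrace exchange_big/=; apply: eq_bigr => i _.
by rewrite mxE; apply: eq_bigr => j _; rewrite mxE.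
Qed.

Lemma frob0r A : frob A 0 = 0.
Proof. by rewrite /frob mulmx0 mxtrace0. Qed.

Lemma frobDl A B C : frob (A + B) C = frob A C + frob B C.
Proof. by rewrite frobC frobDr !(frobC C). Qed.

Lemma frobZl A k B : frob (k *: A) B = k * frob A B.
Proof. by rewrite frobC frobZr frobC. Qed.

Lemma frobBr A B C : frob A (B - C) = frob A B - frob A C.
Proof. by rewrite -scaleN1r frobDr frobZr mulN1r. Qed.

Lemma frobBl A B C : frob (A - B) C = frob A C - frob B C.
Proof. by rewrite frobC frobBr !(frobC C). Qed.

Lemma frob_ge0 A : 0 <= frob A A.
Proof.
rewrite frobE; apply: sumr_ge0 => k _; apply: sumr_ge0 => l _.
by rewrite -expr2 sqr_ge0.
Qed.

Lemma frob_eq0 A : (frob A A == 0) = (A == 0).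
Proof.
apply/idP/eqP => [|->]; last by rewrite frob0r.
rewrite frobE psumr_eq0 => [/allP A0|i _]; last first.
  by apply: sumr_ge0 => ? _; rewrite -expr2 sqr_ge0.
apply/matrixP => i j; rewrite mxE; move: (A0 i (mem_index_enum i)) => /=.
rewrite psumr_eq0 => [/allP /(_ j (mem_index_enum j))/=|? _].
  by rewrite -expr2 sqrf_eq0 => /eqP.
by rewrite -expr2 sqr_ge0.
Qed.

Lemma sqr_fnorm A : fnorm A ^+ 2 = frob A A.
Proof. by rewrite sqr_sqrtr ?frob_ge0. Qed.

(** The squared norm of [|A|^2 B - <A,B> A] equals [|A|^2] times the gap between the two sides; a
    vanishing [A] is treated apart. *)
Lemma frob_CauchySchwarz A B : frob A B ^+ 2 <= frob A A * frob B B.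
Proof.
have [/eqP|A0] := eqVneq (frob A A) 0.
  rewrite frob_eq0 => /eqP ->.
  by rewrite frobC !frob0r mul0r expr0n.
have : 0 <= frob (frob A A *: B - frob A B *: A) (frob A A *: B - frob A B *: A).
  exact: frob_ge0.
rewrite !(frobBl, frobBr, frobZl, frobZr) (frobC B A).
have {}A0 : 0 < frob A A by rewrite lt_neqAle eq_sym A0 frob_ge0.
set a := frob A A in A0 *; set b := frob A B; set c := frob B B.
rewrite (_ : _ - _ = a * (a * c - b ^+ 2)); last by ring.
by rewrite pmulr_rge0// subr_ge0.
Qed.

Lemma frob_le_fnorm A B : `|frob A B| <= fnorm A * fnorm B.
Proof.
rewrite -(@ler_pXn2r _ 2)// ?nnegrE ?mulr_ge0 ?sqrtr_ge0//.
by rewrite exprMn !sqr_fnorm real_normK ?num_real// frob_CauchySchwarz.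
Qed.

Lemma fcos_itv A B : -1 <= fcos A B <= 1.
Proof.
rewrite -ler_norml /fcos normrM normfV.
rewrite [`|_ * _|]ger0_norm ?mulr_ge0 ?sqrtr_ge0//.
(* If a norm vanishes, the quotient is [0], since the inverse of [0] is [0]. *)
have [->|ab0] := eqVneq (fnorm A * fnorm B) 0; first by rewrite invr0 mulr0 ler01.
rewrite ler_pdivrMr ?mul1r ?frob_le_fnorm//.
by rewrite lt_neqAle eq_sym ab0 mulr_ge0// sqrtr_ge0.
Qed.

Lemma normr_entry_le_fnorm A i j : `|A i j| <= fnorm A.
Proof.
rewrite -(@ler_pXn2r _ 2)// ?nnegrE ?sqrtr_ge0// sqr_fnorm real_normK ?num_real//.
rewrite frobE (bigD1 i)//= (bigD1 j)//= -expr2 -addrA lerDl addr_ge0//.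
  by apply: sumr_ge0 => ? _; rewrite -expr2 sqr_ge0.
by apply: sumr_ge0 => k _; apply: sumr_ge0 => l _; rewrite -expr2 sqr_ge0.
Qed.

Lemma fnormD A B : fnorm (A + B) <= fnorm A + fnorm B.
Proof.
rewrite -(@ler_pXn2r _ 2)// ?nnegrE ?addr_ge0 ?sqrtr_ge0//.
rewrite sqrrD !sqr_fnorm frobDl !frobDr (frobC B A).
have := le_trans (ler_norm _) (frob_le_fnorm A B).
by set a := frob A A; set b := frob A B; set c := frob B B => ?; lra.
Qed.

End frobenius_theory.

Section coordinates.
Context {R : realType} {n : nat}.

Section frame.
Context {m : nat} (E : m.-tuple 'M[R]_n).

Lemma of_coordD x y : of_coord E (x + y) = of_coord E x + of_coord E y.
Proof.
by rewrite -big_split; apply: eq_bigr => i _; rewrite mxE scalerDl.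
Qed.

Lemma of_coordZ k x : of_coord E (k *: x) = k *: of_coord E x.
Proof.
by rewrite scaler_sumr; apply: eq_bigr => i _; rewrite mxE scalerA.
Qed.

Lemma of_coordB x y : of_coord E (x - y) = of_coord E x - of_coord E y.
Proof. by rewrite of_coordD -scaleN1r of_coordZ scaleN1r. Qed.

End frame.

Context {g : {vspace 'M[R]_n}} (E : (\dim g).-tuple 'M[R]_n).
Hypothesis onE : orthonormal_basis E.

Lemma of_coordK : cancel (of_coord E) (to_coord E).
Proof.
move=> x; apply/rowP => i; rewrite mxE frob_sumr (bigD1 i)//= frobZr onE.2 eqxx.
rewrite mulr1 big1 ?addr0// => j ji.
by rewrite frobZr onE.2 eq_sym (negbTE ji) mulr0.
Qed.

Lemma frob_of_coord x y : frob (of_coord E x) (of_coord E y) = (x *m y^T) 0 0.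
Proof.
rewrite frobC frob_sumr mxE; apply: eq_bigr => i _; rewrite frobZr mxE frobC.
by rewrite -[in RHS](of_coordK y) mxE.
Qed.

Lemma orth_proj_of_coord x : orth_proj E (of_coord E x) = of_coord E x.
Proof. by rewrite /orth_proj of_coordK. Qed.

(** Elements of the span are orthogonal to what the projection removes. In the linear term of the
    ascent estimate, the raw stochastic gradient may thus replace its projection. *)
Lemma frob_orth_proj x A :
  frob (of_coord E x) (orth_proj E A) = frob (of_coord E x) A.
Proof.
rewrite /orth_proj frob_of_coord mxE [RHS]frobC frob_sumr.
by apply: eq_bigr => i _; rewrite !mxE frobZr (frobC A).
Qed.

(** Pythagoras: the gap is the squared norm of [A - orth_proj E A]. *)
Lemma frob_orth_proj_le A : frob (orth_proj E A) (orth_proj E A) <= frob A A.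
Proof.
have := frob_ge0 (A - orth_proj E A).
rewrite !(frobBl, frobBr) (frobC A) !frob_orth_proj.
by rewrite subrr subr0 subr_ge0.
Qed.

End coordinates.

(** * Spectral theorem for real symmetric matrices and the Kantorovich inequality *)

Section conjugated_diagonal.
Context {K : fieldType} {k : nat}.
Variable P : 'M[K]_k.
Hypothesis Pu : P \in unitmx.
Implicit Types d e : 'rV[K]_k.

Lemma conj_diag_mul d e :
  (invmx P *m diag_mx d *m P) *m (invmx P *m diag_mx e *m P) =
  invmx P *m diag_mx (\row_i (d 0 i * e 0 i)) *m P.
Proof.
rewrite !mulmxA mulmxK// -[X in X *m P = _]mulmxA mulmx_diag.
by congr (_ *m diag_mx _ *m _); apply/rowP => i; rewrite !mxE.
Qed.

Lemma invmx_conj_diag d : (forall i, d 0 i != 0) ->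
  invmx (invmx P *m diag_mx d *m P) =
  invmx P *m diag_mx (\row_i (d 0 i)^-1) *m P.
Proof.
move=> d0; set A := invmx P *m _ *m P.
have AV : A *m (invmx P *m diag_mx (\row_i (d 0 i)^-1) *m P) = 1%:M.
  rewrite conj_diag_mul (_ : \row_i _ = const_mx 1).
    by rewrite diag_const_mx mulmx1 mulVmx.
  by apply/rowP => i; rewrite !mxE mulfV.
by rewrite -[LHS]mulmx1 -AV mulKmx//; case/mulmx1_unit: AV.
Qed.

End conjugated_diagonal.

Section spectral.
Import complex.
Context {R : realType} {m : nat}.
Local Notation toC := (map_mx (real_complex R)).

Lemma symmetric_spectral (F : 'M[R]_m) : F^T = F ->
  exists (d : 'rV[R]_m) (P : 'M[R[i]%C]_m),
    [/\ P \is unitarymx, forall i, eigenvalue F (d 0 i),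
        forall a, eigenvalue F a -> exists i, a = d 0 i
      & toC F = invmx P *m diag_mx (toC d) *m P].
Proof.
move=> Fsym; set A := toC F.
have Aherm : A \is hermsymmx.
  apply: realsym_hermsym.
    by apply/is_hermitianmxP; rewrite expr0 scale1r map_mx_id//; apply/matrixP => i j;
    by rewrite !mxE -[in LHS]Fsym mxE.
  by apply/mxOverP => i j; rewrite mxE; apply/complex_realP; exists (F i j).
have /hermitian_normalmx /orthomx_spectralP AE := Aherm.
have dreal := hermitian_spectral_diag_real Aherm.
set P := spectralmx A in AE; set D := spectral_diag A in AE dreal.
have Punit : P \in unitmx by exact: spectral_unit.
have DE : D = toC (\row_i complex.Re (D 0 i)).
  apply/rowP => i; rewrite !mxE; apply/esym/RRe_real.
  by move/mxOverP: dreal => /(_ 0 i).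
exists (\row_i complex.Re (D 0 i)), P; split.
- exact: spectral_unitarymx.
- move=> i.
  rewrite -(eigenvalue_map (real_complex R)) -/A; apply/eigenvalueP; exists (row i P).
    rewrite -row_mul [A]AE !mulmxA mulmxV// mul1mx row_mul.
    apply/rowP => j; rewrite row_diag_mx.
    rewrite -scalemxAl mxE -rowE !mxE; congr (_ * _).
    by apply/esym/RRe_real; move/mxOverP: dreal => /(_ 0 i).
  apply/eqP => /(congr1 (mulmx^~ (invmx P))) /eqP.
  rewrite mul0mx -row_mul mulmxV// => /eqP/rowP/(_ i).
  by rewrite !mxE eqxx => /eqP; rewrite oner_eq0.
(* In the coordinates given by [P], an eigenvector for [a] has a nonzero entry [i]; comparing this
   entry on both sides forces [a] to be the [i]-th diagonal value. *)
- move=> a; rewrite -(eigenvalue_map (real_complex R)) -/A => /eigenvalueP[v vA v0].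
  have /rV0Pn[i ui] : v *m invmx P != 0.
    apply: contra v0 => /eqP /(congr1 (mulmx^~ P)).
    by rewrite mulmxKV// mul0mx => ->.
  exists i; apply: (@complexI R).
  have : (v *m invmx P) *m diag_mx D = a%:C%C *: (v *m invmx P).
    by rewrite scalemxAl -vA [A in RHS]AE !mulmxA mulmxK.
  move=> /rowP/(_ i); rewrite mul_mx_diag mxE [RHS]mxE mulrC => /(mulIf ui) <-.
  by rewrite mxE; apply/esym/RRe_real; move/mxOverP: dreal => /(_ 0 i).
- by rewrite -DE.
Qed.


(** The weights are the squared moduli of the coordinates of [v] in the basis given by [P]. They are
    chosen before [G], so that one family serves the identity, [F^-1] and [F^-2] at once. *)
Lemma unitary_quadratic_form (P : 'M[R[i]%C]_m) (v : 'rV[R]_m) :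
  P \is unitarymx ->
  exists w : 'I_m -> R, (forall i, 0 <= w i) /\
    forall (e : 'rV[R]_m) (G : 'M[R]_m),
      toC G = invmx P *m diag_mx (toC e) *m P ->
      (v *m G *m v^T) 0 0 = \sum_i w i * e 0 i.
Proof.
move=> Pu; pose u := toC v *m invmx P.
have wE i : (complex.Re (`|u 0 i| ^+ 2))%:C%C = `|u 0 i| ^+ 2.
  by apply: RRe_real; rewrite realX// normr_real.
exists (fun i => complex.Re (`|u 0 i| ^+ 2)); split=> [i|e G GE].
  by rewrite -ler0c wE exprn_ge0.
apply: (@complexI R); rewrite rmorph_sum.
have -> : ((v *m G *m v^T) 0 0)%:C%C = toC (v *m G *m v^T) 0 0 by rewrite [RHS]mxE.
have uE : P *m (toC v)^T = (map_mx Num.conj u)^T.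
  rewrite /u invmx_unitary// map_mxM trmx_mul.
  congr (_ *m _); apply/matrixP => i j; rewrite !mxE; first exact/esym/conjCK.
  exact/esym/conjc_real.
rewrite !map_mxM -map_trmx GE !mulmxA -mulmxA uE mul_mx_diag mxE.
apply: eq_bigr => i _; rewrite rmorphM/= wE !mxE normCK.
by rewrite mulrAC.
Qed.

Lemma eigenvalue_unitmx_neq0 {K : fieldType} {k} (F : 'M[K]_k) a :
  F \in unitmx -> eigenvalue F a -> a != 0.
Proof.
move=> Fu /eigenvalueP[v vF]; apply: contraNneq => a0.
by rewrite -(mulmxK Fu v) vF a0 scale0r mul0mx.
Qed.

(** The values [d] are fixed before [v] and exhaust the spectrum; this finiteness makes the supremum
    of the eigenvalues an upper bound and their infimum attained in positive dimension. *)
Lemma symmetric_inv_forms (F : 'M[R]_m) : F^T = F -> F \in unitmx ->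
  exists d : 'I_m -> R,
  [/\ forall i, eigenvalue F (d i), forall a, eigenvalue F a -> exists i, a = d i
    & forall v : 'rV[R]_m, exists w : 'I_m -> R,
      [/\ forall i, 0 <= w i, (v *m v^T) 0 0 = \sum_i w i,
          (v *m invmx F *m v^T) 0 0 = \sum_i w i * (d i)^-1
        & (v *m (invmx F *m invmx F) *m v^T) 0 0 = \sum_i w i * (d i)^-1 ^+ 2]].
Proof.
move=> Fsym Fu; have [d [P [Pu dF Fd FE]]] := symmetric_spectral Fsym.
exists (d 0); split=> // v; have [w [w0 wE]] := unitary_quadratic_form v Pu.
have PU := unitarymx_unit Pu.
have d0 i : d 0 i != 0 by exact: eigenvalue_unitmx_neq0 (dF i).
pose e : 'rV[R]_m := \row_i (d 0 i)^-1.
have VE : toC (invmx F) = invmx P *m diag_mx (toC e) *m P.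
  rewrite map_invmx FE invmx_conj_diag => [||i].
  - rewrite (_ : \row_i _ = toC e)//.
    by apply/rowP => i; rewrite !mxE fmorphV.
  - exact: PU.
  - by rewrite mxE fmorph_eq0.
exists w; split=> //.
- rewrite -[X in (X *m _) 0 0 = _]mulmx1 (wE (const_mx 1)).
    by apply: eq_bigr => i _; rewrite mxE mulr1.
  by rewrite map_const_mx diag_const_mx !rmorph1 mulmx1 mulVmx.
- by rewrite (wE e)//; apply: eq_bigr => i _; rewrite mxE.
- rewrite (wE (\row_i (e 0 i) ^+ 2)).
    by apply: eq_bigr => i _; rewrite !mxE.
  rewrite map_mxM VE conj_diag_mul; last exact: PU.
  rewrite (_ : \row_i _ = toC (\row_i e 0 i ^+ 2))//.
  by apply/rowP => i; rewrite !mxE rmorphXn expr2.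
Qed.

End spectral.

Lemma kantorovich {R : rcfType} {m : nat} (w u : 'I_m -> R) (a b : R) :
  (forall i, 0 <= w i) -> 0 < a -> a <= b -> (forall i, b^-1 <= u i <= a^-1) ->
  0 < \sum_i w i ->
  2 * Num.sqrt (b / a) / (b / a + 1) <=
  (\sum_i w i * u i) / (Num.sqrt (\sum_i w i) * Num.sqrt (\sum_i w i * u i ^+ 2)).
Proof.
move=> w0 a0 ab uab S0.
have b0 : 0 < b := lt_le_trans a0 ab.
set s0 := \sum_i w i in S0 *; set s1 := \sum_i _; set s2 := \sum_i _.
have S2 : 0 < s2.
  apply: (@lt_le_trans _ _ (b^-1 ^+ 2 * s0)).
    by rewrite mulr_gt0// exprn_gt0// invr_gt0.
  rewrite mulr_sumr; apply: ler_sum => i _; rewrite mulrC ler_wpM2l//.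
  have /andP[bu _] := uab i.
  by rewrite ler_pXn2r// nnegrE ?invr_ge0 ?ltW// (lt_le_trans _ bu)// invr_gt0.
(* The gap is the sum of the terms [w i * ((u i - b^-1) * (a^-1 - u i))], each nonnegative. *)
have key : s2 + s0 / (a * b) <= (a + b) / (a * b) * s1.
  rewrite mulr_sumr mulr_suml -big_split/=; apply: ler_sum => i _.
  rewrite -subr_ge0; have /andP[bu ua] := uab i.
  have -> : (a + b) / (a * b) * (w i * u i) - (w i * u i ^+ 2 + w i / (a * b)) =
      w i * ((u i - b^-1) * (a^-1 - u i)).
    by field; rewrite !gt_eqF.
  by rewrite !mulr_ge0// subr_ge0.
have sab : 0 < Num.sqrt (b / a) by rewrite sqrtr_gt0 divr_gt0.
(* Arithmetic-geometric mean for [b * s2] and [s0 / a], whose sum is [b] times the left side of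
   [key]. *)
have amgm : 2 * Num.sqrt s0 * Num.sqrt s2 * Num.sqrt (b / a) <= b * s2 + s0 / a.
  have -> : b * s2 + s0 / a = (Num.sqrt (b / a) * Num.sqrt a * Num.sqrt s2) ^+ 2 +
       (Num.sqrt s0 / Num.sqrt a) ^+ 2.
    rewrite !exprMn exprVn !sqr_sqrtr ?ltW ?divr_gt0//.
    by rewrite divfK// gt_eqF.
  have sa0 : Num.sqrt a != 0 by rewrite gt_eqF// sqrtr_gt0.
  rewrite -subr_ge0; set x := Num.sqrt (b / a) in sab *.
  rewrite (_ : _ - _ = (x * Num.sqrt a * Num.sqrt s2 - Num.sqrt s0 / Num.sqrt a) ^+ 2).
    exact: sqr_ge0.
  by field.
have h : 2 * Num.sqrt s0 * Num.sqrt s2 * Num.sqrt (b / a) <= (b / a + 1) * s1.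
  apply: (le_trans amgm).
  have -> : b * s2 + s0 / a = b * (s2 + s0 / (a * b)) by field; rewrite !gt_eqF.
  have -> : (b / a + 1) * s1 = b * ((a + b) / (a * b) * s1) by field; rewrite !gt_eqF.
  by rewrite ler_pM2l.
rewrite ler_pdivrMr ?addr_gt0 ?divr_gt0//.
rewrite mulrAC ler_pdivlMr ?mulr_gt0 ?sqrtr_gt0// [s1 * _]mulrC.
by apply: le_trans h; rewrite le_eqVlt; apply/orP; left; apply/eqP; ring.
Qed.

(** * Quadratic form of the inverse of a positive definite matrix *)

Definition psd {R : realType} {m : nat} (F : 'M[R]_m) : Prop :=
  F^T = F /\ forall v : 'rV[R]_m, 0 <= (v *m F *m v^T) 0 0.

Section positive_definite.
Context {R : realType} {m : nat} (F : 'M[R]_m).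
Hypotheses (Fpsd : psd F) (Fu : F \in unitmx).
Implicit Type v : 'rV[R]_m.

Lemma dot_row_gt0 v : v != 0 -> 0 < (v *m v^T) 0 0.
Proof.
move=> /rV0Pn[i vi]; rewrite mxE (bigD1 i)//= mxE.
rewrite -expr2 ltr_pwDl ?exprn_even_gt0//.
by apply: sumr_ge0 => j _; rewrite mxE -expr2 sqr_ge0.
Qed.

Lemma eigenvalue_gt0 a : eigenvalue F a -> 0 < a.
Proof.
move=> Fa; rewrite lt_neqAle eq_sym (eigenvalue_unitmx_neq0 Fu Fa)/=.
move/eigenvalueP : Fa => [v vF /dot_row_gt0 v0].
by have := Fpsd.2 v; rewrite vF -scalemxAl mxE pmulr_lge0.
Qed.

(** The supremum and infimum bound the spectrum only because it is bounded: above by the sum of the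
    [|d i|], below by [0]. *)
Lemma lambda_bounds a :
  eigenvalue F a -> lambda_min F <= a /\ a <= lambda_max F.
Proof.
have [d [_ Fd _]] := symmetric_inv_forms Fpsd.1 Fu.
move=> Fa; split; last first.
  apply: ub_le_sup => //; exists (\sum_i `|d i|) => b /= /Fd[i ->].
  by rewrite (bigD1 i)//= (le_trans (ler_norm _))// lerDl sumr_ge0.
by apply: ge_inf => //; exists 0 => b /= /eigenvalue_gt0 /ltW.
Qed.

(** The least of the finitely many [d i] is a positive lower bound of the spectrum. In dimension 0
    the spectrum is empty and its infimum is [0] by convention. *)
Lemma lambda_min_gt0 : (0 < m)%N -> 0 < lambda_min F.
Proof.
move=> m0; have [d [dF Fd _]] := symmetric_inv_forms Fpsd.1 Fu.
have [i _ idm] := @arg_minP _ _ _ (Ordinal m0) xpredT d isT.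
apply: (lt_le_trans (eigenvalue_gt0 (dF i))).
apply: lb_le_inf; first by exists (d i); exact: dF.
by move=> _ /= /Fd[j ->]; exact: idm.
Qed.

Lemma lambda_min_ge0 : 0 <= lambda_min F.
Proof.
have [S0|/set0P S0] := eqVneq [set a | eigenvalue F a] set0.
  by rewrite /lambda_min S0 inf0.
by apply: lb_le_inf => // a /= /eigenvalue_gt0 /ltW.
Qed.

Lemma cond_number_ge1 : (0 < m)%N -> 1 <= cond_number F.
Proof.
move=> m0; have [d [dF _ _]] := symmetric_inv_forms Fpsd.1 Fu.
have [la aL] := lambda_bounds (dF (Ordinal m0)).
by rewrite /cond_number ler_pdivlMr ?mul1r ?lambda_min_gt0// (le_trans la).
Qed.

Lemma trmx_inv_row v : (invmx F *m v^T)^T = v *m invmx F.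
Proof. by rewrite trmx_mul trmxK trmx_inv Fpsd.1. Qed.

Lemma inv_form_bounds v :
  (lambda_max F)^-1 * (v *m v^T) 0 0 <= (v *m invmx F *m v^T) 0 0 /\
  (v *m invmx F *m v^T) 0 0 <= (lambda_min F)^-1 * (v *m v^T) 0 0.
Proof.
have [d [dF _ /(_ v)[w [w0 -> -> _]]]] := symmetric_inv_forms Fpsd.1 Fu.
rewrite !mulr_sumr; split; apply: ler_sum => i _; rewrite [_^-1 * w i]mulrC ler_wpM2l//;
  have [la aL] := lambda_bounds (dF i); have d0 := eigenvalue_gt0 (dF i).
  by rewrite lef_pV2// posrE (lt_le_trans d0).
by rewrite lef_pV2// posrE lambda_min_gt0// (leq_ltn_trans _ (ltn_ord i)).
Qed.

Lemma inv_form_cos v : v != 0 ->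
  2 * Num.sqrt (cond_number F) / (cond_number F + 1) <=
  (v *m invmx F *m v^T) 0 0 /
  (Num.sqrt ((v *m v^T) 0 0) *
   Num.sqrt ((v *m invmx F *m (v *m invmx F)^T) 0 0)).
Proof.
move=> v0; have m0 : (0 < m)%N by have /rV0Pn[[i im] _] := v0; exact: leq_trans im.
have lm0 := lambda_min_gt0 m0.
have [d [dF _ /(_ v)[w [w0 vw v1 v2]]]] := symmetric_inv_forms Fpsd.1 Fu.
(* By symmetry of [F], the squared norm of [v *m invmx F] is the quadratic form of [F^-2] at [v]. *)
rewrite v1 -[X in _ *m X^T]trmx_inv_row trmxK mulmxA -(mulmxA v) v2.
have := dot_row_gt0 v0; rewrite vw => vgt0.
apply: kantorovich => //.
  have [la aL] := lambda_bounds (dF (Ordinal m0)).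
  exact: le_trans la aL.
move=> i; have [la aL] := lambda_bounds (dF i); have d0 := eigenvalue_gt0 (dF i).
by rewrite !lef_pV2 ?posrE// ?la ?aL// (lt_le_trans d0).
Qed.

End positive_definite.

Lemma kantorovich_ratio_le1 {R : rcfType} (k : R) : 0 <= k ->
  2 * Num.sqrt k / (k + 1) <= 1.
Proof.
move=> k0; rewrite ler_pdivrMr ?ltr_wpDl// mul1r -subr_ge0.
have := sqr_sqrtr k0; set s := Num.sqrt k => <-.
rewrite (_ : _ - _ = (s - 1) ^+ 2) ?sqr_ge0//.
by ring.
Qed.

(** With [a] and [b] the roots of [k] and [l], clearing denominators leaves [2 (b - a) (a b - 1)],
    which is nonnegative for [1 <= a <= b]. *)
Lemma kantorovich_ratio_anti {R : rcfType} (k l : R) : 1 <= k -> k <= l ->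
  2 * Num.sqrt l / (l + 1) <= 2 * Num.sqrt k / (k + 1).
Proof.
move=> k1 kl; have k0 : 0 <= k by rewrite (le_trans ler01).
have l0 : 0 <= l by rewrite (le_trans k0).
rewrite ler_pdivrMr ?ltr_wpDl// mulrAC ler_pdivlMr ?ltr_wpDl//.
have a1 : 1 <= Num.sqrt k by rewrite -[leLHS]sqrtr1 ler_wsqrtr.
have ab : Num.sqrt k <= Num.sqrt l by rewrite ler_wsqrtr.
move: (sqr_sqrtr k0) (sqr_sqrtr l0) a1 ab.
set a := Num.sqrt k; set b := Num.sqrt l => <- <- a1 ab; rewrite -subr_ge0.
rewrite (_ : _ - _ = 2 * ((b - a) * (a * b - 1))); last by ring.
rewrite !mulr_ge0// subr_ge0// -[1]mulr1 ler_pM//.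
exact: le_trans a1 ab.
Qed.

(** * Fisher matrix of a Gaussian policy *)

Section gram.
Context {R : realType} {d : measure_display} {T : measurableType d}
  (mu : {measure set T -> \bar R}) {m : nat} (X : 'I_m -> T -> R).
Hypotheses (mX : forall i, measurable_fun setT (X i))
  (X2 : forall i, (\int[mu]_x (X i x ^+ 2)%:E < +oo)%E).

(** Domination of [|x y|] by [x^2 + y^2]. *)
Lemma integrable_mul_of_sqr i j : mu.-integrable setT (fun x => (X i x * X j x)%:E).
Proof.
have sq k : mu.-integrable setT (fun x => (X k x ^+ 2)%:E).
  apply/integrableP; split.
    by apply/measurable_EFinP; exact: measurable_funX.
  by under eq_integral => x _ do rewrite /= ger0_norm ?sqr_ge0//; exact: X2.
apply: (@le_integrable _ _ _ mu setT measurableT _ (fun x => (X i x ^+ 2)%:E + (X j x ^+ 2)%:E)%E).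
- by apply/measurable_EFinP; exact: measurable_funM.
- move=> x _; rewrite -EFinD !abse_EFin lee_fin.
  rewrite [leRHS]ger0_norm ?addr_ge0 ?sqr_ge0// ler_norml.
  have := sqr_ge0 (X i x - X j x); have := sqr_ge0 (X i x + X j x).
  have := sqr_ge0 (X i x); have := sqr_ge0 (X j x).
  move=> a b c e; nra.
- exact: integrableD.
Qed.

(** The quadratic form at [v] is the integral of the square of [\sum_i v 0 i * X i]. *)
Lemma gram_psd : psd (\matrix_(i, j) fine (\int[mu]_x (X i x * X j x)%:E)%E).
Proof.
split=> [|v].
  apply/matrixP => i j; rewrite !mxE.
  by congr fine; apply: eq_integral => x _; rewrite mulrC.
have -> : ((v *m \matrix_(i, j) fine (\int[mu]_x (X i x * X j x)%:E)%E) *m v^T) 0 0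
    = fine (\int[mu]_x ((\sum_i v 0 i * X i x) ^+ 2)%:E)%E.
  have -> : (\int[mu]_x ((\sum_i v 0 i * X i x) ^+ 2)%:E
      = \int[mu]_x \sum_j \sum_i (v 0 i * v 0 j)%:E * (X i x * X j x)%:E)%E.
    apply: eq_integral => x _; under [RHS]eq_bigr => j _.
      under eq_bigr => i _ do rewrite -EFinM.
      rewrite sumEFin; over.
    rewrite sumEFin expr2 mulr_sumr; congr (_%:E); apply: eq_bigr => j _.
    rewrite mulr_suml; apply: eq_bigr => i _; ring.
  have ic i j : mu.-integrable setT
      (fun x => (v 0 i * v 0 j)%:E * (X i x * X j x)%:E)%E.
    by apply: integrableZl => //; exact: integrable_mul_of_sqr.
  rewrite integral_sum//; last by move=> j; exact: integrable_sum.
  rewrite mxE -sum_fine; last first.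
    by move=> j _; apply: integrable_fin_num => //; exact: integrable_sum.
  apply: eq_bigr => j _; rewrite integral_sum// -sum_fine; last first.
    by move=> i _; apply: integrable_fin_num.
  rewrite !mxE mulr_suml; apply: eq_bigr => i _.
  rewrite integralZl//; last exact: integrable_mul_of_sqr.
  rewrite fineM//; last by apply: integrable_fin_num => //; exact: integrable_mul_of_sqr.
  by rewrite !mxE/= mulrAC.
by apply: fine_ge0; apply: integral_ge0 => x _; rewrite lee_fin sqr_ge0.
Qed.

End gram.

(** Serves the Gaussian log-density, which is quadratic along every coordinate line: for [h != 0]
    the difference quotient is [b + h * c]. *)
Lemma derive_quadratic {R : realType} {V : normedModType R} (f : V -> R)
    (x v : V) (b c : R) :
  (forall h, f (h *: v + x) = f x + h * b + h ^+ 2 * c) -> 'D_v f x = b.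
Proof.
move=> fE; apply/cvg_lim => //.
apply: (@cvg_trans _ ((fun h : R => b + h * c) @ 0^')).
  apply: near_eq_cvg; near=> h.
  have h0 : h != 0 by near: h; exact: nbhs_dnbhs_neq.
  rewrite /= fE; rewrite /GRing.scale/=; field.
  by [].
apply: cvg_trans; first exact/cvg_app/cvg_within.
rewrite -[X in _ --> X]addr0 -[X in _ + X](mul0r c).
by apply: cvgD; [exact: cvg_cst|apply: cvgMl; exact: cvg_id].
Unshelve. all: by end_near. Qed.

Lemma ln_prod {R : realType} (I : finType) (f : I -> R) :
  (forall i, 0 < f i) -> ln (\prod_i f i) = \sum_i ln (f i).
Proof.
move=> f0; suff [_ ->] : 0 < \prod_i f i /\ ln (\prod_i f i) = \sum_i ln (f i) by [].
elim/big_rec2 : _ => [|i y z _ [z0 zE]]; first by rewrite ln1.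
by rewrite mulr_gt0// lnM ?posrE// zE.
Qed.

Section score.
Context {R : realType} {n m : nat} {dS : measure_display}
  {S : measurableType dS}.
Variables (E : m.-tuple 'M[R]_n) (Phi : 'I_m -> S -> 'M[R]_n) (sigma : R).
Hypothesis sigma_gt0 : 0 < sigma.

Lemma to_coord_mean theta s i :
  to_coord E (mean Phi theta s) 0 i = \sum_k theta 0 k * frob (tnth E i) (Phi k s).
Proof. by rewrite mxE frob_sumr; apply: eq_bigr => k _; rewrite frobZr. Qed.

Lemma to_coord_mean_line (theta : 'rV[R]_m) s i (k : 'I_m) h :
  to_coord E (mean Phi (h *: delta_mx 0 k + theta) s) 0 i =
  h * frob (tnth E i) (Phi k s) + to_coord E (mean Phi theta s) 0 i.
Proof.
rewrite !to_coord_mean; under eq_bigr => l _ do rewrite !mxE mulrDl.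
rewrite big_split/= (bigD1 k)//= eqxx mulr1; congr (_ + _).
by rewrite big1 ?addr0// => l lk; rewrite (negbTE lk) mulr0 mul0r.
Qed.

Lemma ln_policy_pdf theta s a : ln (policy_pdf E Phi sigma theta s a) =
  \sum_i (ln (normal_peak sigma) -
    ((tnth a i : R) - to_coord E (mean Phi theta s) 0 i) ^+ 2 / (sigma ^+ 2 *+ 2)).
Proof.
have s0 : sigma != 0 by rewrite gt_eqF.
have pk := normal_peak_gt0 s0.
rewrite ln_prod => [|i]; last by rewrite normal_pdfE// mulr_gt0// expR_gt0.
apply: eq_bigr => i _.
by rewrite normal_pdfE// lnM ?posrE ?expR_gt0// expRK mulNr.
Qed.

(** The action minus its mean is the noise [xi], so the score is linear in [xi] and does not involve
    [theta]. *)
Lemma score_act theta s xi k :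
  score E Phi sigma theta s (act E Phi theta s xi) 0 k =
  \sum_i (tnth xi i : R) * frob (tnth E i) (Phi k s) / sigma ^+ 2.
Proof.
rewrite mxE; apply: (@derive_quadratic _ _ _ _ _ _
  (\sum_i - (frob (tnth E i) (Phi k s) ^+ 2 / (sigma ^+ 2 *+ 2)))) => h.
rewrite !ln_policy_pdf !mulr_sumr -!big_split/=; apply: eq_bigr => i _.
rewrite to_coord_mean_line tnth_mktuple.
set u := frob _ _; set t := to_coord _ _ _ _; set x := tnth xi i.
have s0 : sigma != 0 by rewrite gt_eqF.
by field.
Qed.

End score.

Section fisher_psd.
Context {R : realType} {n m : nat} {dS : measure_display}
  {S : measurableType dS}.
Variables (E : m.-tuple 'M[R]_n) (Phi : 'I_m -> S -> 'M[R]_n) (sigma : R).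
Hypotheses (sigma_gt0 : 0 < sigma)
  (mPhi : forall k i j, measurable_fun setT (fun s => Phi k s i j)).

(** The score as a random variable on the product of the state and noise spaces, in the form given
    by [score_act]. *)
Let sc k (z : S * euclidean R m) : R :=
  \sum_i (tnth z.2 i : R) * frob (tnth E i) (Phi k z.1) / sigma ^+ 2.

Let measurable_sc k : measurable_fun setT (sc k).
Proof.
apply: measurable_sum => i; apply: measurable_funM => //.
apply: measurable_funM.
  apply: (measurableT_comp (f := fun y : euclidean R m => tnth y i)) => //.
  exact: measurable_tnth.
apply: (measurableT_comp (f := fun s => frob (tnth E i) (Phi k s))) => //.
under eq_fun do rewrite frobE.
apply: measurable_sum => a; apply: measurable_sum => b.
exact: measurable_funM.
Qed.

(** Tonelli carries the finite second moments of the score from iterated integrals to the product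
    measure. Fubini then identifies the Fisher matrix with the Gram matrix of the [sc k]. *)
Let finite_fisher_psd (mu : {finite_measure set S -> \bar R}) theta :
  fisher_finite E Phi sigma mu theta -> psd (fisher E Phi sigma mu theta).
Proof.
move=> fin.
have sqf k : (\int[mu \x gaussian m sigma]_z (sc k z ^+ 2)%:E < +oo)%E.
  rewrite fubini_tonelli1/=; last 2 first.
  - by apply/measurable_EFinP; exact: measurable_funX.
  - by move=> z; rewrite lee_fin sqr_ge0.
  apply: le_lt_trans (fin k); rewrite le_eqVlt; apply/orP; left; apply/eqP.
  apply: eq_integral => s _; apply: eq_integral => xi _.
  by rewrite score_act.
have := gram_psd measurable_sc sqf; congr psd.
apply/matrixP => i j; rewrite !mxE; congr fine.
rewrite /policy_expectation -integral12_prod_meas1/=; last first.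
  exact: integrable_mul_of_sqr.
apply: eq_integral => s _; apply: eq_integral => xi _.
by rewrite !score_act.
Qed.

Section finite.
Variable mu : {measure set S -> \bar R}.
Hypothesis mu_fin : fin_num_fun mu.

(** A copy of [mu] to which the structure of finite measure can be attached, as [mu] is declared
    only as a measure. *)
Let fmu : set S -> \bar R := mu.

HB.instance Definition _ := Measure.on fmu.

HB.instance Definition _ := Measure_isFinite.Build _ _ _ fmu mu_fin.

Lemma fisher_psd theta :
  fisher_finite E Phi sigma mu theta -> psd (fisher E Phi sigma mu theta).
Proof. exact: (finite_fisher_psd (mu := fmu)). Qed.

End finite.

End fisher_psd.

(** The mass is [1 - gamma] times a geometric series with ratio [gamma < 1], each state distribution
    having mass 1. *)
Lemma visitation_fin {R : realType} {dS dA dO : measure_display} {S : measurableType dS}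
  {A : measurableType dA} {Omega : measurableType dO}
  (M : mdp R S A) (s : nat -> {mfun Omega >-> S}) (P : probability Omega R) :
  fin_num_fun (visitation M s P).
Proof.
apply: lty_fin_num_fun; rewrite /visitation /= /mscale/= /mseries.
rewrite lte_mul_pinfty ?lee_fin ?subr_ge0 ?ltW ?disc_lt1//.
have sE t : mscale ((disc M)%:num ^+ t)%:nng (distribution P (s t)) setT =
    ((disc M)%:num ^+ t)%:E.
  rewrite -[LHS]/(((disc M)%:num ^+ t)%:E * P (s t @^-1` setT))%E.
  by rewrite preimage_setT probability_setT mule1.
rewrite (eq_eseriesr (g := fun t => ((disc M)%:num ^+ t)%:E)); last first.
  by move=> t _; exact: sE.
have d1 : `|(disc M)%:num| < 1 by rewrite ger0_norm// disc_lt1.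
under eq_fun do rewrite sumEFin.
rewrite EFin_lim ?ltry//.
rewrite (_ : (fun n => _) = series (geometric 1 (disc M)%:num)).
  exact: is_cvg_geometric_series.
by apply/funext => k; apply: eq_bigr => i _; rewrite /= mul1r.
Qed.

(** * Ascent lemma *)

Section line.
Context {R : realType} {m : nat}.
Variables (f : 'rV[R]_m -> R).
Hypothesis df : forall x, differentiable f x.

Lemma derive_gradient x p : 'D_p f x = (gradient f x *m p^T) 0 0.
Proof.
rewrite deriveE// {1}(row_sum_delta p) linear_sum mxE; apply: eq_bigr => i _.
by rewrite linearZ/= !mxE deriveE// mulrC.
Qed.

Lemma is_derive_line x p (h : R) :
  is_derive h 1 (fun h => f (h *: p + x)) ((gradient f (h *: p + x) *m p^T) 0 0).
Proof.
have fE : (fun h' : R => h'^-1 *: (((fun h => f (h *: p + x)) \o shift h) (h' *: 1)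
      - f (h *: p + x))) =
    (fun h' : R => h'^-1 *: ((f \o shift (h *: p + x)) (h' *: p) - f (h *: p + x))).
  apply/funext => h' /=; congr (_ *: (f _ - _)).
  by rewrite [h' *: 1]mulr1 scalerDl addrA.
split; first by rewrite /derivable fE; exact: diff_derivable.
by rewrite -derive_gradient /derive fE.
Qed.

End line.

Section ascent.
Context {R : realType} {n : nat} {g : {vspace 'M[R]_n}}
  (E : (\dim g).-tuple 'M[R]_n).
Hypothesis onE : orthonormal_basis E.
Variables (J : 'rV[R]_(\dim g) -> R) (L : R).
Hypotheses (dJ : forall x, differentiable J x)
  (lipJ : forall x y, fnorm (lie_grad E J x - lie_grad E J y) <=
                      L * fnorm (of_coord E (x - y))).

Lemma smooth_ascent x p :
  J x + frob (lie_grad E J x) (of_coord E p) - L / 2 * fnorm (of_coord E p) ^+ 2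
  <= J (p + x).
Proof.
set c := frob _ _; set k := fnorm (of_coord E p).
(* The increment of [psi] over [[0, 1]] is exactly the gap to be shown nonnegative, so by the mean
   value theorem a nonnegative derivative inside suffices. *)
pose psi (h : R) := J (h *: p + x) + h * (- c) + h ^+ 2 * (L / 2 * k ^+ 2).
pose dpsi (h : R) := frob (lie_grad E J (h *: p + x)) (of_coord E p) - c +
  h * (L * k ^+ 2).
have dpsiP (h : R) : is_derive h 1 psi (dpsi h).
  have := is_derive_line dJ x p h; rewrite -(frob_of_coord onE) => dline.
  rewrite /psi; apply: is_derive_eq.
  rewrite /dpsi /lie_grad /GRing.scale/=.
  rewrite !mulr0 !add0r !mulr1; congr (_ + _).
  by field.
have [|h h01 psiE] := @MVT _ psi dpsi 0 1 ltr01 (fun h _ => dpsiP h).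
  apply: derivable_within_continuous => h _.
  by have [] := dpsiP h.
move: h01; rewrite in_itv/= => /andP[h0 h1].
suff : 0 <= dpsi h.
  rewrite -[dpsi h]mulr1 -[X in _ * X](subr0 1) -psiE /psi !scale1r !scale0r add0r.
  by move=> ?; lra.
(* The two points are at distance [h * k]; Cauchy-Schwarz and the Lipschitz bound give at most what
   the quadratic term of [psi] contributes to the derivative. *)
have : `|frob (lie_grad E J (h *: p + x) - lie_grad E J x) (of_coord E p)| <=
    L * (h * k) * k.
  apply: (le_trans (frob_le_fnorm _ _)); rewrite ler_wpM2r ?sqrtr_ge0//.
  apply: (le_trans (lipJ _ _)); rewrite addrK of_coordZ.
  by rewrite {1}/fnorm frobZl frobZr mulrA -expr2 sqrtrM ?sqr_ge0// sqrtr_sqr gtr0_norm.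
rewrite ler_norml frobBl => /andP[+ _]; rewrite /dpsi -/c.
have -> : h * (L * k ^+ 2) = L * (h * k) * k by ring.
by move=> ?; rewrite -lerBlDr sub0r.
Qed.

End ascent.

(** * Orthogonality of the gradient noise to the past *)

Section conditional_expectation.
Context {R : realType} {dW : measure_display} {W : measurableType dW}.
Variable Q : probability W R.
Implicit Types (X Y D : W -> R).

Lemma ae_bounded_integrableM Y D (b : R) : measurable_fun setT Y ->
  Q.-integrable setT (EFin \o D) -> {ae Q, forall w, `|Y w| <= b} ->
  Q.-integrable setT (fun w => (Y w * D w)%:E).
Proof.
move=> mY iD Yb; have mD : measurable_fun setT D.
  exact/measurable_EFinP/(measurable_int Q iD).
apply/integrableP; split.
  by apply/measurable_EFinP; exact: measurable_funM.
apply: (@le_lt_trans _ _ (\int[Q]_w (`|b| * `|D w|)%:E)%E).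
  apply: ae_ge0_le_integral => //.
  - by apply/measurable_EFinP; apply: measurableT_comp => //; exact: measurable_funM.
  - by apply/measurable_EFinP; apply: measurable_funM => //; exact: measurableT_comp.
  apply: filterS Yb => w Yw _ /=; rewrite lee_fin normrM ler_wpM2r//.
  by rewrite (le_trans Yw)// ler_norm.
under eq_integral do rewrite EFinM.
rewrite integralZl//; last exact: integrable_norm.
by rewrite lte_mul_pinfty ?lee_fin//; case/integrableP : iD.
Qed.

Lemma integral_indicM D H : measurable H -> 
  (\int[Q]_w (\1_H w * D w)%:E = \int[Q]_(w in H) (D w)%:E)%E.
Proof.
move=> mH; rewrite [RHS]integral_mkcond; apply: eq_integral => w _.
by rewrite patchE indicE; case: ifP => _; rewrite ?mul1r ?mul0r.
Qed.

Variable G : set (set W).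
Hypothesis Gm : forall H, G H -> measurable H.

(* Rounding Y down to a multiple of e makes the pairing with D a finite sum of
   integrals of D over events of G. *)
Lemma integral_adapted_mul_eq0 Y D (b : R) :
  (forall B : set (measurableTypeR R), measurable B -> G (Y @^-1` B)) ->
  Q.-integrable setT (EFin \o D) -> {ae Q, forall w, `|Y w| <= b} ->
  (forall H, G H -> (\int[Q]_(w in H) (D w)%:E = 0)%E) ->
  (\int[Q]_w (Y w * D w)%:E = 0)%E.
Proof.
move=> GY iD Yb D0.
have mY : measurable_fun setT Y.
  by move=> _ B mB; rewrite setTI; exact/Gm/GY.
have mD : measurable_fun setT D.
  exact/measurable_EFinP/(measurable_int Q iD).
have iYD := ae_bounded_integrableM mY iD Yb.
have DE : (\int[Q]_w `|(D w)%:E| < +oo)%E by case/integrableP : iD.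
(* It suffices to bound the integral by arbitrarily small multiples of the finite first moment [a]
   of [|D|]; the choice [e / (a + 1)] below allows [a = 0]. *)
suff bound (e : R) : 0 < e ->
    (`| \int[Q]_w (Y w * D w)%:E| <= e%:E * \int[Q]_w `|(D w)%:E|)%E.
  apply/eqP; rewrite -abse_eq0 eq_le abse_ge0 andbT.
  have [a a0 aE] : exists2 a : R, 0 <= a & (\int[Q]_w `|(D w)%:E|)%E = a%:E.
    exists (fine (\int[Q]_w `|(D w)%:E|)%E); first exact/fine_ge0/integral_ge0.
    by rewrite fineK// ge0_fin_numE// integral_ge0.
  apply/lee_addgt0Pr => e e0; rewrite add0e.
  apply: (le_trans (bound (e / (a + 1)) _)).
    by rewrite divr_gt0// ltr_wpDl.
  rewrite aE -EFinM lee_fin mulrAC ler_pdivrMr ?ltr_wpDl// ler_wpM2l ?ltW//.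
  by rewrite ltrDl.
move=> e0.
(* [N] cells of width [e] on each side of [0] cover the almost sure range of [Y]; shifting by [N]
   makes the cell indices natural numbers. *)
pose N := (Num.truncn (`|b| / e)).+1.
have bN : `|b| < N%:R * e by rewrite -ltr_pdivrMr// /N truncnS_gt.
pose B (j : nat) : set (measurableTypeR R) :=
  [set y : R | j%:R <= y / e + N%:R < j.+1%:R].
have mB j : measurable (B j).
  rewrite (_ : B j = `[(j%:R - N%:R) * e, (j.+1%:R - N%:R) * e[%classic) //.
  by apply/seteqP; split=> y; rewrite /B /= in_itv/=;
    rewrite -ler_pdivlMr// -ltr_pdivrMr// lerBlDr ltrBrDr.
pose Ye w := \sum_(j < N + N) ((j%:R - N%:R) * e) * \1_(Y @^-1` B j) w.
have mYe : measurable_fun setT Ye.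
  apply: measurable_sum => j; apply: measurable_funM => //.
  by apply: measurable_indic; exact: Gm (GY _ (mB j)).
have Yeb : {ae Q, forall w, `|Y w - Ye w| <= e}.
  apply: filterS Yb => w Yw.
  have : `|Y w| < N%:R * e by rewrite (le_lt_trans Yw)// (le_lt_trans (ler_norm b)).
  rewrite -ltr_pdivrMr// -[e in _ / e](gtr0_norm e0) -normfV -normrM ltr_norml => /andP[y1 y2].
  set y := Y w / e in y1 y2.
  have yN : 0 <= y + N%:R by lra.
  have /andP[t1 t2] := truncn_itv yN.
  have tN : (Num.truncn (y + N%:R) < N + N)%N.
    by rewrite -(ltr_nat R) natrD (le_lt_trans t1)// ltrD2r.
  (* Exactly one indicator is nonzero at [w], the one indexed by the integer part of
     [Y w / e + N%:R]. *)
  have -> : Ye w = ((Num.truncn (y + N%:R))%:R - N%:R) * e.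
    rewrite /Ye (bigD1 (Ordinal tN))//= big1 => [|j jt].
      by rewrite addr0 indicE mem_set ?mulr1// /B/= -/y t1.
    rewrite indicE memNset ?mulr0// /B/= -/y => jy.
    by move/eqP : jt; apply; apply/val_inj => /=; exact/esym/truncn_def.
  have -> : Y w = y * e by rewrite divfK// gt_eqF.
  rewrite -mulrBl normrM (gtr0_norm e0) ler_piMl ?(ltW e0)//.
  rewrite -natr1 in t2.
  by rewrite ler_norml; apply/andP; split; lra.
(* Each cell pulls back to an event of [G], over which [D] integrates to [0]. *)
have YeD0 : (\int[Q]_w (Ye w * D w)%:E = 0)%E.
  rewrite (_ : (\int[Q]_w _)%E = (\int[Q]_w \sum_(j < N + N)
     (((j%:R - N%:R) * e)%:E * (\1_(Y @^-1` B j) w * D w)%:E))%E); last first.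
    apply: eq_integral => w _; rewrite /Ye mulr_suml -sumEFin.
    by apply: eq_bigr => j _; rewrite -EFinM mulrA.
  have ii (j : 'I_(N + N)) : Q.-integrable setT (fun w => (\1_(Y @^-1` B j) w * D w)%:E).
    apply: (ae_bounded_integrableM (b := 1)) => //.
      by apply: measurable_indic; exact: Gm (GY _ (mB j)).
    by apply: aeW => w; rewrite indicE; case: (_ \in _); rewrite ?normr1 ?normr0.
  rewrite integral_sum//; last by move=> j; exact: integrableZl.
  rewrite big1// => j _; rewrite integralZl//.
  by rewrite integral_indicM ?D0 ?mule0//; [exact: GY _ (mB j)|exact: Gm (GY _ (mB j))].
have iYeD : Q.-integrable setT (fun w => ((Y w - Ye w) * D w)%:E).
  by apply: ae_bounded_integrableM Yeb => //; exact: measurable_funB.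
have -> : (\int[Q]_w (Y w * D w)%:E = \int[Q]_w ((Y w - Ye w) * D w)%:E)%E.
  have iYe : Q.-integrable setT (fun w => (Ye w * D w)%:E).
    apply: (@eq_integrable _ _ _ _ _ _ ((fun w => (Y w * D w)%:E)
      \- (fun w => ((Y w - Ye w) * D w)%:E))%E) => //.
      by move=> w _ /=; rewrite -EFinB; congr EFin; ring.
    exact: integrableB.
  rewrite -[RHS]adde0 -YeD0 -integralD//; apply: eq_integral => w _.
  by rewrite -EFinD; congr EFin; ring.
apply: (le_trans (le_abse_integral _ _ _)) => //; first exact: measurable_int iYeD.
rewrite -ge0_integralZl_EFin//; last 2 first.
- by apply: measurableT_comp => //; exact/measurable_EFinP.
- exact: ltW.
apply: ae_ge0_le_integral => //.
- by apply: measurableT_comp => //; exact: measurable_int iYeD.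
- by move=> w _; rewrite mule_ge0// lee_fin ltW.
- by apply: emeasurable_funM => //; apply: measurableT_comp => //; exact/measurable_EFinP.
apply: filterS Yeb => w Yw _ /=.
by rewrite lee_fin normrM ler_wpM2r.
Qed.

End conditional_expectation.

Section matrix_conditional_expectation.
Context {R : realType} {n : nat} {dW : measure_display} {W : measurableType dW}.
Variables (Q : probability W R) (G : set (set W)).
Hypothesis Gm : forall H, G H -> measurable H.
Variables (X Y : W -> 'M[R]_n) (b : R).
Hypotheses (XY : forall i j,
    cond_expectation Q G (fun w => X w i j) (fun w => Y w i j))
  (Yb : {ae Q, forall w, fnorm (Y w) <= b}).

Let mY i j : measurable_fun setT (fun w => Y w i j).
Proof. by have [_ GY _] := XY i j; move=> _ B mB; rewrite setTI; exact/Gm/GY. Qed.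

Let mX i j : measurable_fun setT (fun w => X w i j).
Proof. by have [iX _ _] := XY i j; exact/measurable_EFinP/(measurable_int Q iX). Qed.

Let Yijb i j : {ae Q, forall w, `|Y w i j| <= b}.
Proof.
by apply: filterS Yb => w; apply: le_trans; exact: normr_entry_le_fnorm.
Qed.

Let iY i j : Q.-integrable setT (fun w => (Y w i j)%:E).
Proof.
have i1 : Q.-integrable setT (EFin \o cst (1 : R)).
  exact: (finite_measure_integrable_cst Q).
have := ae_bounded_integrableM (mY i j) i1 (Yijb i j).
by apply: eq_integrable => // w _ /=; rewrite mulr1.
Qed.

Let iXY i j : Q.-integrable setT (EFin \o (fun w => X w i j - Y w i j)).
Proof.
have [iX _ _] := XY i j.
exact: (integrableB measurableT iX (iY i j)).
Qed.

Lemma integrable_frob_bounded : Q.-integrable setT (fun w => (frob (Y w) (Y w))%:E).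
Proof.
under eq_fun do rewrite frobE -sumEFin.
apply: integrable_sum => // i _; under eq_fun do rewrite -sumEFin.
apply: integrable_sum => // j _.
exact: ae_bounded_integrableM (mY i j) (iY i j) (Yijb i j).
Qed.

Lemma integrable_frob_noise :
  Q.-integrable setT (fun w => (frob (Y w) (X w - Y w))%:E).
Proof.
under eq_fun do rewrite frobE -sumEFin.
apply: integrable_sum => // i _; under eq_fun do rewrite -sumEFin.
apply: integrable_sum => // j _; under eq_fun do rewrite !mxE.
exact: ae_bounded_integrableM (mY i j) (iXY i j) (Yijb i j).
Qed.

(** Entrywise, the noise integrates to [0] over every event of [G], hence also against the bounded
    entries of [Y], which are measurable for [G]. *)
Lemma integral_frob_noise : (\int[Q]_w (frob (Y w) (X w - Y w))%:E = 0)%E.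
Proof.
have iM i j := ae_bounded_integrableM (mY i j) (iXY i j) (Yijb i j).
transitivity (\int[Q]_w \sum_i \sum_j (Y w i j * (X w i j - Y w i j))%:E)%E.
  apply: eq_integral => w _; rewrite frobE -sumEFin; apply: eq_bigr => i _.
  by rewrite -sumEFin; apply: eq_bigr => j _; rewrite !mxE.
rewrite integral_sum//; last by move=> i; exact: integrable_sum.
rewrite big1// => i _; rewrite integral_sum// big1// => j _.
have [iX GY XYH] := XY i j.
apply: (integral_adapted_mul_eq0 Gm GY (iXY i j) (Yijb i j)) => H GH.
have mH := Gm GH.
under eq_integral do rewrite EFinB.
rewrite integralB//; [|exact: integrableS iX|exact: integrableS (iY i j)].
by rewrite XYH// subee// integrable_fin_num//; exact: integrableS (iY i j).
Qed.

Lemma measurable_sqr_fnorm_noise :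
  measurable_fun setT (fun w => fnorm (X w - Y w) ^+ 2).
Proof.
under eq_fun do rewrite sqr_fnorm frobE.
apply: measurable_sum => i; apply: measurable_sum => j.
under eq_fun do rewrite !mxE.
by apply: measurable_funM; exact: measurable_funB.
Qed.

Lemma integrable_sqr_fnorm_noise c :
  (\int[Q]_w (fnorm (X w - Y w) ^+ 2)%:E <= c%:E)%E ->
  Q.-integrable setT (fun w => (fnorm (X w - Y w) ^+ 2)%:E).
Proof.
move=> Qc; apply/integrableP; split.
  exact/measurable_EFinP/measurable_sqr_fnorm_noise.
by under eq_integral => w _ do rewrite /= ger0_norm ?sqr_ge0//;
  rewrite (le_lt_trans Qc)// ltry.
Qed.

End matrix_conditional_expectation.

Lemma past_measurable {R : realType} {n : nat} {dW : measure_display}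
    {W : measurableType dW} (ghat : nat -> W -> 'M[R]_n) t :
  (forall t i j, measurable_fun setT (fun w => ghat t w i j)) ->
  forall H, past ghat t H -> measurable H.
Proof.
move=> mg; apply: smallest_sub; first exact: sigma_algebra_measurable.
move=> _ [u [i [j [B [_ mB ->]]]]]; rewrite -[X in measurable X]setTI.
exact: mg.
Qed.

(** Testing the conditional variance bound on the whole space yields the unconditional one. *)
Lemma pastT {R : realType} {n : nat} {dW : measure_display}
    {W : measurableType dW} (ghat : nat -> W -> 'M[R]_n) t : past ghat t setT.
Proof.
have [s0 sC _] := smallest_sigma_algebra setT [set H | exists u i j
  (B : set (measurableTypeR R)),
  [/\ (u < t)%N, measurable B & H = (fun w => ghat u w i j) @^-1` B]].
by rewrite -(setD0 setT); exact: sC.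
Qed.

(** * Convergence of stochastic gradient ascent *)

Section convergence.
Context {R : realType} {n : nat} {g : {vspace 'M[R]_n}}
  (E : (\dim g).-tuple 'M[R]_n).
Hypothesis onE : orthonormal_basis E.
Variables (J : 'rV[R]_(\dim g) -> R) (L : R).
Local Notation gradJ := (lie_grad E J).
Hypotheses (L_gt0 : 0 < L) (dJ : forall x, differentiable J x)
  (lipJ : forall x y, fnorm (gradJ x - gradJ y) <= L * fnorm (of_coord E (x - y)))
  (supJ : has_ubound (range J)).

Lemma ascent_step x y (A : 'M[R]_n) (e : R) : 0 <= e <= 1 / L ->
  of_coord E y = of_coord E x + e *: orth_proj E A ->
  e / 2 * frob (gradJ x) (gradJ x)
    + (e - L * e ^+ 2) * frob (gradJ x) (A - gradJ x)
    - L * e ^+ 2 / 2 * fnorm (A - gradJ x) ^+ 2 <= J y - J x.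
Proof.
move=> /andP[e0]; rewrite ler_pdivlMr// => eL xy.
have := smooth_ascent onE dJ lipJ x (y - x).
rewrite subrK of_coordB xy [of_coord E x + _]addrC addrK frobZr frob_orth_proj//.
rewrite sqr_fnorm frobZl frobZr.
have PA : frob (orth_proj E A) (orth_proj E A) <=
    frob (gradJ x) (gradJ x) + 2 * frob (gradJ x) (A - gradJ x)
      + fnorm (A - gradJ x) ^+ 2.
  apply: (le_trans (frob_orth_proj_le onE A)).
  rewrite sqr_fnorm !(frobBl, frobBr) (frobC A (gradJ x)).
  by rewrite le_eqVlt; apply/orP; left; apply/eqP; ring.
rewrite -[X in frob (lie_grad E J x) X](subrK (gradJ x)) frobDr.
have N0 : 0 <= frob (gradJ x) (gradJ x) := frob_ge0 _.
set N := frob (gradJ x) (gradJ x) in PA N0 *.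
set C := frob (gradJ x) (A - gradJ x) in PA *.
set D := fnorm _ ^+ 2 in PA *.
set P := frob _ _ in PA *.
have : L / 2 * (e * (e * P)) <= L / 2 * e ^+ 2 * (N + 2 * C + D).
  by rewrite expr2 !mulrA ler_wpM2l// !mulr_ge0// ltW.
(* Half of this slack, due to [e <= 1 / L], lowers the coefficient of [N] from [e - L * e ^+ 2 / 2]
   to [e / 2]. *)
have : 0 <= e * (1 - e * L) * N by rewrite !mulr_ge0// subr_ge0.
move=> h1 h2 h3; nra.
Qed.

Context {dW : measure_display} {W : measurableType dW} (Q : probability W R).
Variables (theta0 : 'rV[R]_(\dim g)) (theta : nat -> W -> 'rV[R]_(\dim g))
  (ghat : nat -> W -> 'M[R]_n) (eta : nat -> R) (Btheta sigma_g : R).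
Hypotheses
  (mg : forall t i j, measurable_fun setT (fun w => ghat t w i j))
  (theta_0 : forall w, theta 0%N w = theta0)
  (thetaS : forall t w, of_coord E (theta t.+1 w) =
     of_coord E (theta t w) + eta t *: orth_proj E (ghat t w))
  (theta_bnd : {ae Q, forall w, forall t, fnorm (of_coord E (theta t w)) <= Btheta})
  (unbiased : forall t i j, cond_expectation Q (past ghat t)
     (fun w => ghat t w i j) (fun w => gradJ (theta t w) i j))
  (noise : forall t, cond_expectation_le Q (past ghat t)
     (fun w => fnorm (ghat t w - gradJ (theta t w)) ^+ 2) (sigma_g ^+ 2)).

Let N t w := frob (gradJ (theta t w)) (gradJ (theta t w)).
Let C t w := frob (gradJ (theta t w)) (ghat t w - gradJ (theta t w)).
Let D t w := fnorm (ghat t w - gradJ (theta t w)) ^+ 2.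

(** Lipschitz comparison with the gradient at the origin turns bounded iterates into bounded
    gradients, as the noise lemmas require. *)
Let grad_bnd t : {ae Q, forall w,
  fnorm (gradJ (theta t w)) <= fnorm (gradJ 0) + L * Btheta}.
Proof.
apply: filterS theta_bnd => w /(_ t) tw.
rewrite -[gradJ (theta t w)](subrK (gradJ 0)) addrC.
apply: (le_trans (fnormD _ _)); rewrite lerD2l.
by apply: (le_trans (lipJ _ _)); rewrite subr0 ler_wpM2l// ltW.
Qed.

Let Gm t := past_measurable (t := t) mg.

Let iN t : Q.-integrable setT (EFin \o N t).
Proof.
exact: (integrable_frob_bounded (X := ghat t)
  (Y := fun w => gradJ (theta t w)) (Gm (t := t)) (unbiased t) (grad_bnd t)).
Qed.

Let iC t : Q.-integrable setT (EFin \o C t).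
Proof.
exact: (integrable_frob_noise (X := ghat t)
  (Y := fun w => gradJ (theta t w)) (Gm (t := t)) (unbiased t) (grad_bnd t)).
Qed.

Let C0 t : (\int[Q]_w (C t w)%:E = 0)%E.
Proof.
exact: (integral_frob_noise (X := ghat t)
  (Y := fun w => gradJ (theta t w)) (Gm (t := t)) (unbiased t) (grad_bnd t)).
Qed.

Let Dle t : (\int[Q]_w (D t w)%:E <= (sigma_g ^+ 2)%:E)%E.
Proof. by have := noise (@pastT _ _ _ _ ghat t); rewrite probability_setT mule1. Qed.

Let iD t : Q.-integrable setT (EFin \o D t).
Proof.
exact: (integrable_sqr_fnorm_noise (X := ghat t)
  (Y := fun w => gradJ (theta t w)) (Gm (t := t)) (unbiased t) (Dle t)).
Qed.

Let telescope T (e : R) : 0 <= e <= 1 / L -> (forall t, (t < T)%N -> eta t = e) ->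
  forall w, \sum_(t < T) (e / 2 * N t w + (e - L * e ^+ 2) * C t w
     - L * e ^+ 2 / 2 * D t w) <= sup (range J) - J theta0.
Proof.
move=> eL eE w.
have le_sup x : J x <= sup (range J) by apply: ub_le_sup => //; exists x.
apply: (@le_trans _ _ (\sum_(t < T) (J (theta t.+1 w) - J (theta t w)))).
  apply: ler_sum => t _; apply: ascent_step => //.
  by rewrite thetaS eE.
rewrite -(big_mkord xpredT (fun t => J (theta t.+1 w) - J (theta t w))).
by rewrite telescope_sumr// theta_0 lerD2r.
Qed.

Let sum_bound T (e : R) : 0 < e <= 1 / L -> (forall t, (t < T)%N -> eta t = e) ->
  \sum_(t < T) fine (\int[Q]_w (N t w)%:E)%E <=
    2 / e * (sup (range J) - J theta0) + T%:R * (L * e * sigma_g ^+ 2).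
Proof.
move=> /andP[e0 eL] eE; have e0L : 0 <= e <= 1 / L by rewrite ltW.
pose f t w := ((e / 2)%:E * (N t w)%:E + (e - L * e ^+ 2)%:E * (C t w)%:E
     - (L * e ^+ 2 / 2)%:E * (D t w)%:E)%E.
have iNC t : Q.-integrable setT
    (fun w => (e / 2)%:E * (N t w)%:E + (e - L * e ^+ 2)%:E * (C t w)%:E)%E.
  by apply: integrableD => //; apply: integrableZl => //; [exact: iN|exact: iC].
have iDe t : Q.-integrable setT (fun w => (L * e ^+ 2 / 2)%:E * (D t w)%:E)%E.
  by apply: integrableZl => //; exact: iD.
have ifE t : Q.-integrable setT (f t) by exact: integrableB.
have fE t : (\int[Q]_w f t w = (e / 2)%:E * \int[Q]_w (N t w)%:E
     - (L * e ^+ 2 / 2)%:E * \int[Q]_w (D t w)%:E)%E.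
  rewrite integralB// integralD//;
    [|by apply: integrableZl => //; exact: iN
     |by apply: integrableZl => //; exact: iC].
  have ZN c : (\int[Q]_w (c%:E * (N t w)%:E) = c%:E * \int[Q]_w (N t w)%:E)%E.
    by apply: integralZl => //; exact: iN.
  have ZC c : (\int[Q]_w (c%:E * (C t w)%:E) = c%:E * \int[Q]_w (C t w)%:E)%E.
    by apply: integralZl => //; exact: iC.
  have ZD c : (\int[Q]_w (c%:E * (D t w)%:E) = c%:E * \int[Q]_w (D t w)%:E)%E.
    by apply: integralZl => //; exact: iD.
  by rewrite ZN ZC ZD C0 mule0 adde0.
have : (\int[Q]_w (\sum_(t < T) f t w) <= (sup (range J) - J theta0)%:E)%E.
  rewrite -[leRHS](mule1) -(probability_setT Q) -integral_cst//.
  apply: le_integral => //; first exact: integrable_sum.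
    exact: (finite_measure_integrable_cst Q).
  move=> w _; have := telescope e0L eE w; rewrite -lee_fin -sumEFin.
  by apply: le_trans; rewrite le_eqVlt; apply/orP; left; apply/eqP; apply: eq_bigr.
rewrite integral_sum//.
have Nfin t : (\int[Q]_w (N t w)%:E = (fine (\int[Q]_w (N t w)%:E))%:E)%E.
  by rewrite fineK//; apply: integrable_fin_num => //; exact: iN.
have Dfin t : (\int[Q]_w (D t w)%:E = (fine (\int[Q]_w (D t w)%:E))%:E)%E.
  by rewrite fineK//; apply: integrable_fin_num => //; exact: iD.
under eq_bigr => t _ do rewrite fE Nfin Dfin -!EFinM -EFinB.
rewrite sumEFin lee_fin big_split/= -mulr_sumr sumrN -mulr_sumr.
have : \sum_(t < T) fine (\int[Q]_w (D t w)%:E)%E <= T%:R * sigma_g ^+ 2.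
  rewrite mulr_natl -[X in _ *+ X]card_ord -sumr_const; apply: ler_sum => t _.
  by rewrite -lee_fin -Dfin.
set SD := \sum_(t < T) _; set SN := \sum_(t < T) _; set K := _ - J _ => SDle h.
have h2 : L * e ^+ 2 / 2 * SD <= L * e ^+ 2 / 2 * (T%:R * sigma_g ^+ 2).
  by apply: ler_wpM2l => //; rewrite divr_ge0// mulr_ge0 ?sqr_ge0// ltW.
rewrite -(@ler_pM2l _ (e / 2)) ?divr_gt0//.
have -> : e / 2 * (2 / e * K + T%:R * (L * e * sigma_g ^+ 2)) =
   K + L * e ^+ 2 / 2 * (T%:R * sigma_g ^+ 2) by field; rewrite gt_eqF.
by lra.
Qed.

Lemma min_expected_sqr_grad T eta0 : constant_steps L T eta0 eta ->
  (\big[Order.min/+oo]_(0 <= t < T)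
     'E_Q[fun w => (fnorm (gradJ (theta t w)) ^+ 2)%R] <=
   (2 * (sup (range J) - J theta0) / (eta0 * Num.sqrt T%:R)
    + L * eta0 * sigma_g ^+ 2 / Num.sqrt T%:R)%:E)%E.
Proof.
move=> [T0 eta0_gt0 eta0L etaE].
have sT0 : 0 < Num.sqrt (T%:R : R) by rewrite sqrtr_gt0 ltr0n.
have sT1 : 1 <= Num.sqrt (T%:R : R) by rewrite -[leLHS]sqrtr1 ler_wsqrtr// ler1n.
(* Since [T >= 1], dividing by its root keeps the step below [1 / L]. *)
have eL : 0 < eta0 / Num.sqrt T%:R <= 1 / L.
  rewrite divr_gt0//= (le_trans _ eta0L)// ler_pdivrMr// ler_peMr// ltW//.
have := sum_bound eL etaE; set K := (X in _ <= X); set c := (X in (_ <= X%:E)%E).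
(* Writing [T] as the square of its root shows the total bound to be [T] times the claimed one, so
   some term is at most the average [c]. *)
have -> : K = \sum_(t < T) c.
  rewrite sumr_const card_ord -mulr_natl /K /c; have := sqr_sqrtr (ler0n R T).
  set s := Num.sqrt T%:R in sT0 *; move=> <-.
  by field; rewrite !gt_eqF.
move=> sum_le.
have [t tc] : exists t : 'I_T, fine (\int[Q]_w (N t w)%:E)%E <= c.
  apply/not_existsP => h; move: sum_le; rewrite leNgt => /negP; apply.
  apply: ltr_sum => [|t _]; last by rewrite ltNge; exact/negP/h.
  by apply/hasP; exists (Ordinal T0); rewrite ?mem_index_enum.
apply: (@bigmin_inf_seq _ _ _ _ _ (t : nat)) => //.
  by rewrite mem_index_iota/=.
rewrite unlock; under eq_integral do rewrite sqr_fnorm.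
by rewrite -[leLHS]fineK ?lee_fin//; apply: integrable_fin_num => //; exact: iN.
Qed.

End convergence.

(** * Alignment with the natural gradient *)

Section natural_gradient.
Context {R : realType} {n : nat} {g : {vspace 'M[R]_n}}
  (E : (\dim g).-tuple 'M[R]_n).
Hypothesis onE : orthonormal_basis E.
Variables (J : 'rV[R]_(\dim g) -> R) (F : 'rV[R]_(\dim g) -> 'M[R]_(\dim g)).

Lemma orth_proj_lie_grad x : orth_proj E (lie_grad E J x) = lie_grad E J x.
Proof. exact: orth_proj_of_coord. Qed.

Section point.
Variable x : 'rV[R]_(\dim g).
Hypotheses (Fpsd : psd (F x)) (Fu : F x \in unitmx).

Let nat_gradE : nat_grad E J F x = of_coord E (gradient J x *m invmx (F x)).
Proof. by rewrite /nat_grad (trmx_inv_row Fpsd). Qed.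

Lemma frob_nat_grad : frob (lie_grad E J x) (nat_grad E J F x) =
  (gradient J x *m invmx (F x) *m (gradient J x)^T) 0 0.
Proof. by rewrite nat_gradE frobC frob_of_coord. Qed.

Lemma nat_grad_bounds :
  (lambda_max (F x))^-1 * fnorm (lie_grad E J x) ^+ 2
    <= frob (lie_grad E J x) (nat_grad E J F x) /\
  frob (lie_grad E J x) (nat_grad E J F x)
    <= (lambda_min (F x))^-1 * fnorm (lie_grad E J x) ^+ 2.
Proof. by rewrite frob_nat_grad sqr_fnorm frob_of_coord//; exact: inv_form_bounds. Qed.

Lemma grad_cos_ge : gradient J x != 0 ->
  2 * Num.sqrt (cond_number (F x)) / (cond_number (F x) + 1) <= grad_cos E J F x.
Proof.
move=> J0; rewrite /grad_cos orth_proj_lie_grad /fcos frob_nat_grad.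
by rewrite /fnorm nat_gradE !frob_of_coord//; exact: inv_form_cos.
Qed.

End point.

Context {dW : measure_display} {W : measurableType dW} (Q : probability W R).
Variable theta : nat -> W -> 'rV[R]_(\dim g).
Local Notation alignment := (alignment E J F Q theta).

Lemma best_alignment_exists alpha : alignment alpha ->
  exists2 alpha_max, best_alignment E J F Q theta alpha_max & alpha <= alpha_max.
Proof.
move=> al; set S := [set b | alignment b].
have S1 : has_sup S.
  by split; [exists alpha|exists 1 => b [/andP[]]].
have leS b : alignment b -> b <= sup S by move=> ?; exact: ub_le_sup S1.2 _ _.
exists (sup S); last exact: leS.
split; last exact: leS.
split.
  rewrite (lt_le_trans _ (leS _ al)); last by case: al => /andP[].
  by apply: ge_sup; [exists alpha|move=> b [/andP[]]].
(* Each parameter in this sequence has its own null set; as there are countably many, one null set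
   serves all [k], and the inequality passes to the supremum. *)
have /choice[b bS] (k : nat) : exists b, alignment b /\ sup S - k.+1%:R^-1 < b.
  have [|b ? ?] := @sup_adherent _ S (k.+1%:R^-1) _ S1; first by rewrite invr_gt0.
  by exists b.
have : {ae Q, forall w, forall k t, gradient J (theta t w) != 0 ->
    b k <= grad_cos E J F (theta t w)}.
  apply/ae_foralln => k; by have [[]] := bS k.
apply: filterS => w bw t J0; apply/ler_addgt0Pl => e e0.
have [k ke] : exists k, k.+1%:R^-1 < e.
  by exists (Num.truncn e^-1); rewrite invf_plt ?posrE// truncnS_gt.
have [_ bk] := bS k; rewrite addrC -lerBlDr; apply: le_trans (bw k t J0).
by apply: le_trans (ltW bk); rewrite lerD2l lerN2 ltW.
Qed.

Lemma alignment_of_cond_number alpha kappa :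
  (forall x, psd (F x)) ->
  {ae Q, forall w, forall t, F (theta t w) \in unitmx} ->
  {ae Q, forall w, forall t, cond_number (F (theta t w)) <= kappa} ->
  best_alignment E J F Q theta alpha ->
  2 * Num.sqrt kappa / (kappa + 1) <= alpha.
Proof.
move=> Fpsd Fu Fk [[/andP[alpha0 _] _] best].
(* For [kappa <= 0] the root is [0] by convention, so the ratio is [0], below the positive
   [alpha]. *)
have [k0|k0] := leP kappa 0.
  by rewrite ler0_sqrtr// mulr0 mul0r ltW.
apply: best; split.
  by rewrite kantorovich_ratio_le1 ?(ltW k0)// divr_gt0 ?mulr_gt0 ?sqrtr_gt0// addr_gt0.
apply: filterS2 Fu Fk => w Fu Fk t J0.
apply: le_trans (grad_cos_ge (Fpsd _) (Fu t) J0).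
apply: kantorovich_ratio_anti => //; apply: cond_number_ge1 => //.
(* A nonzero gradient has a nonzero coordinate, so the dimension is positive and the condition
   number is at least 1. *)
by have /rV0Pn[[i im] _] := J0; exact: leq_ltn_trans im.
Qed.

End natural_gradient.

(** * Monotonicity of the arccosine and assembly of the three claims *)

Lemma acos_anti {R : realType} (x y : R) :
  -1 <= x <= 1 -> -1 <= y <= 1 -> x <= y -> acos y <= acos x.
Proof.
move=> x1 y1; rewrite !leNgt; apply: contra.
by rewrite -ltr_cos ?acosK ?in_itv//= ?acos_ge0 ?acos_lepi.
Qed.

Unset Implicit Arguments.

Theorem proposition7p4 (R : realType) (n : nat)
  (* matrix Lie algebra with a Frobenius-orthonormal basis *)
  (g : {vspace 'M[R]_n}) (g_lie : lie_algebra g)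
  (E : (\dim g).-tuple 'M[R]_n) (E_orth : orthonormal_basis E)
  (* decision process and Gaussian policy class *)
  (dS : measure_display) (S : measurableType dS)
  (M : mdp R S (euclidean R (\dim g)))
  (Phi : 'I_(\dim g) -> S -> 'M[R]_n)
  (Phi_in : forall k s, Phi k s \in g)
  (Phi_meas : forall k i j,
    measurable_fun [set: S] (fun s => Phi k s i j : measurableTypeR R))
  (sigma : R) (sigma_gt0 : 0 < sigma)
  (* state-action process, with law Pr x under the policy of parameter x *)
  (dO : measure_display) (Omega : measurableType dO)
  (st : nat -> {mfun Omega >-> S})
  (ac : nat -> {mfun Omega >-> euclidean R (\dim g)})
  (Pr : 'rV[R]_(\dim g) -> probability Omega R)
  (Pr_law : forall x, trajectory_law M st ac (policy E Phi sigma x) (Pr x))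
  (Pr_return : forall x, return_integrable M st ac (Pr x))
  (fisher_fin : forall x,
    fisher_finite E Phi sigma (visitation M st (Pr x)) x)
  (* stochastic gradient ascent *)
  (dW : measure_display) (W : measurableType dW) (Q : probability W R)
  (theta0 : 'rV[R]_(\dim g)) (theta : nat -> W -> 'rV[R]_(\dim g))
  (ghat : nat -> W -> 'M[R]_n) (eta : nat -> R)
  (L Btheta sigma_g alpha : R) :
  let J x := fine ('E_(Pr x)[total_return M st ac])%E in
  let F x := fisher E Phi sigma (visitation M st (Pr x)) x in
  let gradJ := lie_grad E J in
  let gradgJ x := orth_proj E (gradJ x) in
  let natJ := nat_grad E J F in
  let Jstar := sup (range J) in
  (forall t i j,
     measurable_fun [set: W] (fun w => ghat t w i j : measurableTypeR R)) ->
  (forall w, theta 0%N w = theta0) ->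
  (forall t w, of_coord E (theta t.+1 w) =
     of_coord E (theta t w) + eta t *: orth_proj E (ghat t w)) ->
  (* (A1) *)
  0 < L ->
  (forall x, differentiable J x) ->
  (forall x y, fnorm (gradJ x - gradJ y) <= L * fnorm (of_coord E (x - y))) ->
  (* (A2) *)
  has_ubound (range J) ->
  (* (A3) *)
  {ae Q, forall w, forall t, fnorm (of_coord E (theta t w)) <= Btheta} ->
  (* (A4) *)
  (forall t i j, cond_expectation Q (past ghat t)
     (fun w => ghat t w i j) (fun w => gradJ (theta t w) i j)) ->
  (* (A5) *)
  (forall t, cond_expectation_le Q (past ghat t)
     (fun w => fnorm (ghat t w - gradJ (theta t w)) ^+ 2) (sigma_g ^+ 2)) ->
  (* (A6) *)
  (robbins_monro eta \/ exists T eta0, constant_steps L T eta0 eta) ->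
  (* the Fisher matrix is invertible along the trajectory *)
  {ae Q, forall w, forall t, F (theta t w) \in unitmx} ->
  alignment E J F Q theta alpha ->
  [/\ (* (i) *)
      forall T eta0, constant_steps L T eta0 eta ->
        (\big[Order.min/+oo]_(0 <= t < T)
            'E_Q[fun w => (fnorm (gradgJ (theta t w)) ^+ 2)%R] <=
         (2 * (Jstar - J theta0) / (eta0 * Num.sqrt T%:R)
          + L * eta0 * sigma_g ^+ 2 / Num.sqrt T%:R)%:E)%E,
      (* (ii) *)
      {ae Q, forall w, forall t,
        let x := theta t w in
        [/\ (lambda_max (F x))^-1 * fnorm (gradgJ x) ^+ 2
              <= frob (gradJ x) (natJ x),
            frob (gradJ x) (natJ x)
              <= (lambda_min (F x))^-1 * fnorm (gradgJ x) ^+ 2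
          & forall eps, fnorm (gradgJ x) ^+ 2 <= eps ->
              frob (gradJ x) (natJ x) <= eps / lambda_min (F x)]},
      (* (iii) at each iterate, with kappa the condition number there *)
      {ae Q, forall w, forall t,
        let x := theta t w in
        let kappa := cond_number (F x) in
        gradient J x != 0 ->
        [/\ alpha <= fcos (gradgJ x) (natJ x),
            acos (fcos (gradgJ x) (natJ x)) <= acos alpha
          & 2 * Num.sqrt kappa / (kappa + 1) <= fcos (gradgJ x) (natJ x)]}
    & (* (iii) for the sharp alignment parameter, with kappa any bound on the
         condition numbers along the trajectory *)
      exists alpha_max, [/\ best_alignment E J F Q theta alpha_max,
        alpha <= alpha_max
        & forall kappa,
            {ae Q, forall w, forall t, cond_number (F (theta t w)) <= kappa} ->
            2 * Num.sqrt kappa / (kappa + 1) <= alpha_max]].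
Proof.
move=> J F gradJ gradgJ natJ Jstar mghat theta_0 thetaS L0 dJ lipJ supJ bnd.
move=> unbiased noise _ Fu al.
(* Positive semidefiniteness holds at every parameter; invertibility, known almost surely at the
   iterates, upgrades it there to definiteness. *)
have Fpsd x : psd (F x).
  exact: fisher_psd sigma_gt0 Phi_meas _ (visitation_fin _ _ _) _ (fisher_fin x).
have gE : gradgJ = gradJ by apply/funext => x; exact: orth_proj_lie_grad.
split.
- move=> T eta0 steps.
  rewrite gE.
  exact: (min_expected_sqr_grad E_orth L0 dJ lipJ supJ mghat theta_0 thetaS
    bnd unbiased noise steps).
- apply: filterS Fu => w Fu t; set x := theta t w.
  have [lo hi] := nat_grad_bounds E_orth J (Fpsd x) (Fu t).
  rewrite gE; split; [exact: lo|exact: hi|move=> eps le_eps].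
  apply: (le_trans hi).
  (* Nonnegativity of [lambda_min] is enough here and also covers dimension 0. *)
  by rewrite mulrC ler_wpM2r// invr_ge0; exact: lambda_min_ge0 (Fpsd x) (Fu t).
- have [/andP[a0 a1] ae_al] := al.
  apply: filterS2 Fu ae_al => w Fu al_w t J0.
  set x := theta t w in J0 *.
  have alx := al_w t J0; split=> //.
  + apply: acos_anti => //; last exact: fcos_itv.
    by rewrite a1 andbT (le_trans _ (ltW a0))// lerN10.
  + exact: (grad_cos_ge E_orth (Fpsd x) (Fu t) J0).
- have [alpha_max best le_best] := best_alignment_exists al.
  exists alpha_max; split=> // kappa Fk.
  by have := alignment_of_cond_number E_orth Fpsd Fu Fk best.
Qed.
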